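(* Let $G$ be a DQS odd unicyclic graph of order $n\geq 7$, and let $r,s$ be natural numbers. Then $G\cup rK_1\cup sK_2$ is DQS.
   Context: All graphs are finite, simple and undirected. The signless Laplacian matrix of $G$ is $Q(G)=D(G)+A(G)$ ($D(G)$ the diagonal degree matrix, $A(G)$ the adjacency matrix); its multiset of eigenvalues is the $Q$-spectrum. A graph is DQS if every graph with the same $Q$-spectrum is isomorphic to it. A connected graph with $n$ vertices and $n$ edges is unicyclic; it is odd unicyclic if its unique cycle has odd length. $K_m$ is the complete graph on $m$ vertices, $\cup$ is disjoint union, and $rK_1$, $sK_2$ denote disjoint unions of $r$ copies of $K_1$ and $s$ copies of $K_2$. *)

(* Defs.v *)
From mathcomp Require Import all_boot all_order all_algebra all_field.
Set Implicit Arguments.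
Unset Strict Implicit.
Unset Printing Implicit Defensive.
Import GRing.Theory.
Local Open Scope ring_scope.

Record sgraph := SGraph {
  vertex :> finType;
  adj : rel vertex;
  adj_sym : symmetric adj;
  adj_irrefl : irreflexive adj }.
Arguments adj {s}.

Section Graphs.
Variable G : sgraph.

Definition degree (x : G) : nat := #|[set y | adj x y]|.

Definition edges : {set {set G}} := [set [set p.1; p.2] | p : G * G & adj p.1 p.2].

Definition connected : Prop := (0 < #|G|)%N /\ forall x y : G, connect adj x y.

(* The bound on the size excludes [:: x; y], which traverses an edge twice. *)
Definition is_cycle (c : seq G) : Prop := ucycle adj c /\ (2 < size c)%N.

Definition unicyclic : Prop := connected /\ #|edges| = #|G|.

(* The cycle of a unicyclic graph is unique up to rotation and reversal, which
   do not change its length. *)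
Definition odd_unicyclic : Prop :=
  unicyclic /\ exists c : seq G, is_cycle c /\ odd (size c).

Definition degree_mx : 'M[algC]_#|G| :=
  diag_mx (\row_i (degree (enum_val i))%:R).

Definition adjacency_mx : 'M[algC]_#|G| :=
  \matrix_(i, j) (adj (enum_val i) (enum_val j))%:R.

Definition signless_laplacian : 'M[algC]_#|G| := degree_mx + adjacency_mx.

(* The multiset of eigenvalues, listed with algebraic multiplicity in an
   unspecified order: to be compared with perm_eq. *)
Definition Qspectrum : seq algC :=
  sval (closed_field_poly_normal (char_poly signless_laplacian)).

Lemma char_poly_Qspectrum :
  char_poly signless_laplacian = \prod_(a <- Qspectrum) ('X - a%:P).
Proof.
rewrite /Qspectrum; case: closed_field_poly_normal => s /= ->.
by rewrite (monicP (char_poly_monic _)) scale1r.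
Qed.

End Graphs.

Definition isomorphic (G H : sgraph) : Prop :=
  exists f : G -> H, bijective f /\ forall x y : G, adj (f x) (f y) = adj x y.

Definition DQS (G : sgraph) : Prop :=
  forall H : sgraph, perm_eq (Qspectrum H) (Qspectrum G) -> isomorphic H G.

Section Constructions.

Definition complete_adj m : rel 'I_m := fun i j => i != j.

Lemma complete_adj_sym m : symmetric (@complete_adj m).
Proof. by move=> i j; rewrite /complete_adj eq_sym. Qed.

Lemma complete_adj_irrefl m : irreflexive (@complete_adj m).
Proof. by move=> i; rewrite /complete_adj eqxx. Qed.

Definition complete m : sgraph :=
  SGraph (@complete_adj_sym m) (@complete_adj_irrefl m).

Definition union_adj (G H : sgraph) : rel (G + H)%type := fun u v =>
  match u, v with
  | inl x, inl y => adj x y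
  | inr x, inr y => adj x y
  | _, _ => false
  end.

Lemma union_adj_sym (G H : sgraph) : symmetric (@union_adj G H).
Proof. by move=> [x|x] [y|y] //=; exact: adj_sym. Qed.

Lemma union_adj_irrefl (G H : sgraph) : irreflexive (@union_adj G H).
Proof. by move=> [x|x]; exact: adj_irrefl. Qed.

Definition disjoint_union (G H : sgraph) : sgraph :=
  SGraph (@union_adj_sym G H) (@union_adj_irrefl G H).

Definition copies_adj k (G : sgraph) : rel ('I_k * G)%type := fun u v =>
  (u.1 == v.1) && adj u.2 v.2.

Lemma copies_adj_sym k (G : sgraph) : symmetric (@copies_adj k G).
Proof. by move=> u v; rewrite /copies_adj eq_sym adj_sym. Qed.

Lemma copies_adj_irrefl k (G : sgraph) : irreflexive (@copies_adj k G).
Proof. by move=> u; rewrite /copies_adj adj_irrefl andbF. Qed.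

(* The disjoint union of k copies of G; the empty graph when k = 0. *)
Definition copies k (G : sgraph) : sgraph :=
  SGraph (@copies_adj_sym k G) (@copies_adj_irrefl k G).

End Constructions.

(* Main.v *)
Require Import Defs.
From mathcomp Require Import all_boot all_order all_algebra all_field.
From mathcomp Require Import ring zify.
Set Implicit Arguments.
Unset Strict Implicit.
Unset Printing Implicit Defensive.
Import Order.TTheory GRing.Theory Num.Theory.
Local Open Scope ring_scope.

(* A graph H with the spectrum of G + r K_1 + s K_2 has as many edges as vertices
   minus the multiplicity of the eigenvalue 0. Every connected component has at
   least as many edges as that, so equality holds in each of them, and every
   component is a tree or an odd unicyclic graph. A spanning tree gives
   Q = N B N^T with N unimodular and B a coordinate projection, plus z z^T in the
   unicyclic case. This shows that, for a component of order n,
   - the product of the nonzero eigenvalues is n for a tree and 4 for an odd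
     unicyclic graph;
   - 2 is at most a simple eigenvalue, because B - 2 N^-1 N^-T has an odd
     principal minor;
   - in the unicyclic case the coefficient of X in det(X + Q) is (1 + 2a) n
     modulo 4.
   Dividing det(X + Q) by the powers of X and X + 2, the products of the
   remaining constant terms leave few possibilities: no unicyclic component
   forces n <= 6 for the order of G, two of them, or a tree of order 4, contradict
   the congruence modulo 4, and otherwise all trees are K_1 or K_2 and the
   unicyclic component has the spectrum of G. *)

(** * Adjugates and matrix pencils *)

Lemma deriv_prod (R : comNzRingType) (I : eqType) (s : seq I) (F : I -> {poly R}) :
  uniq s -> (\prod_(i <- s) F i)^`() =
            \sum_(i <- s) (F i)^`() * \prod_(j <- s | j != i) F j.
Proof.
elim: s => [|a s IHs] /=; first by rewrite !big_nil derivC.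
case/andP=> a_s uniq_s; rewrite !big_cons derivM IHs // eqxx /=; congr (_ * _ + _).
  rewrite big_seq [RHS]big_seq_cond; apply: eq_bigl => j; rewrite andbC.
  by have [->|//] := eqVneq; rewrite (negPf a_s).
rewrite big_distrr big_seq [RHS]big_seq /=; apply: eq_bigr => i i_s.
rewrite big_cons; have -> : a != i by apply: contraNneq a_s => ->.
by rewrite mulrCA.
Qed.

(** Jacobi's formula: in the Leibniz expansion the product rule differentiates one row at a time,
    and expanding each resulting determinant along that row produces the cofactors of [M]. *)
Lemma deriv_det (R : comNzRingType) n (M : 'M[{poly R}]_n) :
  (\det M)^`() = \sum_i \sum_j (M i j)^`() * cofactor M i j.
Proof.
pose M' i := \matrix_(k, j) if k == i then (M k j)^`() else M k j.
transitivity (\sum_i \det (M' i)); last first.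
  apply: eq_bigr => i _; rewrite (expand_det_row _ i); apply: eq_bigr => j _.
  rewrite mxE eqxx; congr (_ * (_ * \det _)); apply/matrixP => k l.
  by rewrite !mxE eq_sym (negPf (neq_lift _ _)).
rewrite /determinant raddf_sum exchange_big /=; apply: eq_bigr => s _.
have derivZsign (b : bool) (p : {poly R}) : ((-1) ^+ b * p)^`() = (-1) ^+ b * p^`().
  by case: b; rewrite ?expr0 ?expr1 ?mul1r // !mulN1r derivN.
rewrite derivZsign.
rewrite deriv_prod ?index_enum_uniq // big_distrr /=; apply: eq_bigr => i _.
rewrite [in RHS](bigD1 i) //= mxE eqxx; congr (_ * (_ * _)).
by apply: eq_bigr => j /negPf ji; rewrite mxE ji.
Qed.

(** The direction [K] is general because a unimodular congruence [Q = N B N^T] trades [Q + X] for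
    [B + X K] with [K = N^-1 N^-T]. *)
Definition pencil (R : comNzRingType) n (B K : 'M[R]_n) : {poly R} :=
  \det (map_mx polyC B + 'X *: map_mx polyC K).

Lemma horner_pencil (R : comNzRingType) n (B K : 'M[R]_n) c :
  (pencil B K).[c] = \det (B + c *: K).
Proof.
rewrite -horner_evalE /pencil -det_map_mx; congr (\det _); apply/matrixP => i j.
by rewrite !mxE /= /horner_eval !hornerE.
Qed.

Lemma horner_deriv_pencil (R : comNzRingType) n (B K : 'M[R]_n) c :
  (pencil B K)^`().[c] = \tr (K *m \adj (B + c *: K)).
Proof.
rewrite /pencil deriv_det horner_sum; apply: eq_bigr => i _.
rewrite mxE horner_sum; apply: eq_bigr => j _.
rewrite hornerM !mxE derivD derivM !derivC derivX mul1r mulr0 add0r addr0 hornerC.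
rewrite -horner_evalE -cofactor_map_mx; congr (_ * cofactor _ _ _).
by apply/matrixP => k l; rewrite !mxE /= /horner_eval !hornerE.
Qed.

Lemma trmx_adj_sym (R : comNzRingType) n (C : 'M[R]_n) : C^T = C -> (\adj C)^T = \adj C.
Proof. by move=> symC; rewrite trmx_adj symC. Qed.

(** Replacing row [k] of [C] by a unit vector gives [C'] of determinant [\adj C k k], which is
    nonzero. The combination [x] of two columns of [\adj C] lies in the kernel of [C] and has [k]-th
    coordinate 0, so [C'] kills it and [x = 0]. *)
Lemma adj_rank1 (R : idomainType) n (C : 'M[R]_n) i j k :
  \det C = 0 -> \adj C k k != 0 -> \adj C i j * \adj C k k = \adj C i k * \adj C k j.
Proof.
move=> detC0; set A := \adj C; set c := A k k => nz_c.
pose C' := \matrix_(a, b) if a == k then (b == k)%:R else C a b.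
have detC' : \det C' = c.
  rewrite (expand_det_row _ k) (bigD1 k) //= big1 ?addr0 => [|b /negPf bk].
    rewrite !mxE !eqxx mul1r /c /A mxE; congr (_ * \det _).
    by apply/matrixP => a b; rewrite !mxE eq_sym (negPf (neq_lift _ _)).
  by rewrite !mxE eqxx bk mul0r.
pose x := c *: col j A - A k j *: col k A.
have Cx : C *m x = 0.
  rewrite mulmxBr -!scalemxAr !colE !mulmxA mul_mx_adj detC0 raddf0 !mul0mx.
  by rewrite !scaler0 subr0.
clearbody A; have xk : x k 0 = 0 by rewrite !mxE /c mulrC subrr.
have C'x : C' *m x = 0.
  apply/matrixP => a b; rewrite ord1 [RHS]mxE.
  have [->|ak] := eqVneq a k.
    rewrite mxE (bigD1 k) //= xk mulr0 add0r big1 // => d /negPf dk.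
    by rewrite mxE eqxx dk mul0r.
  rewrite -[RHS](_ : (C *m x) a 0 = 0); last by rewrite Cx mxE.
  by rewrite !mxE; apply: eq_bigr => d _; rewrite !mxE (negPf ak).
have : (\adj C' *m (C' *m x)) i 0 = 0 by rewrite C'x mulmx0 mxE.
rewrite mulmxA mul_adj_mx detC' mul_scalar_mx mxE => /eqP.
by rewrite mulf_eq0 (negPf nz_c) /= !mxE subr_eq0 mulrC => /eqP ->; rewrite mulrC.
Qed.

(* The adjugate has rank one, so its trace against [L L^T] is, up to a nonzero
   factor, a sum of squares. *)
Lemma tr_mul_adj_neq0 n (L C : 'M[int]_n) k :
  L \in unitmx -> C^T = C -> \det C = 0 -> \adj C k k != 0 ->
  \tr (L *m L^T *m \adj C) != 0.
Proof.
move=> uL symC detC0 nz_c; set A := \adj C; set c := A k k.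
have symA i j : A i j = A j i by rewrite /A -[in LHS](trmx_adj_sym symC) mxE.
pose v := col k A.
have cA : c *: A = v *m v^T.
  have vE i : v i 0 = A i k by rewrite [LHS]mxE.
  apply/matrixP => i j; rewrite [LHS]mxE mulrC adj_rank1 // [RHS]mxE big_ord1.
  by rewrite [v^T 0 j]mxE !vE (symA j).
have tr_c : c * \tr (L *m L^T *m A) = \sum_j ((v^T *m L) 0 j) ^+ 2.
  rewrite -mxtraceZ scalemxAr cA mulmxA mxtrace_mulC !mulmxA -mulmxA.
  rewrite -[X in L^T *m X]trmxK -trmx_mul /mxtrace big_ord1 mxE; apply: eq_bigr => j _.
  by rewrite [X in _ * X]mxE expr2.
apply: contra_neq nz_c => tr0; move: tr_c; rewrite tr0 mulr0 => /esym/eqP.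
rewrite psumr_eq0 => [/allP sq0|j _]; last exact: sqr_ge0.
have vL0 : v^T *m L = 0.
  apply/matrixP => a j; rewrite ord1 [RHS]mxE.
  by apply/eqP; rewrite -sqrf_eq0; apply: sq0; rewrite mem_index_enum.
have v0 : v^T = 0 by rewrite -[v^T](mulmxK uL) vL0 mul0mx.
by have := congr1 (fun w : 'rV_n => w 0 k) v0; rewrite !mxE.
Qed.

Lemma cofactor_eq1 (R : comNzRingType) n (M : 'M[R]_n) k :
  (forall i j, i != k -> j != k -> M i j = (i == j)%:R) -> cofactor M k k = 1.
Proof.
move=> Mid; rewrite /cofactor -signr_odd addnn odd_double expr0 mul1r.
rewrite [X in \det X](_ : _ = 1%:M) ?det1 //; apply/matrixP => i j.
by rewrite !mxE Mid ?(eq_sym _ k) ?neq_lift // (inj_eq lift_inj).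
Qed.

(** * Rank-one updates of a coordinate projection *)

Section RankOneUpdate.
Variables (n : nat) (k : 'I_n).

Definition unit_col : 'cV[int]_n := delta_mx k 0.
Definition coord_proj : 'M[int]_n := 1%:M - unit_col *m unit_col^T.

Lemma unit_colE i j : unit_col i j = (i == k)%:R.
Proof. by rewrite !mxE ord1 eqxx andbT. Qed.

Lemma coord_projE i j : coord_proj i j = (i == j)%:R - (i == k)%:R * (j == k)%:R.
Proof. by rewrite !mxE big_ord1 [unit_col^T _ _]mxE !unit_colE. Qed.

Lemma trmx_coord_proj : coord_proj^T = coord_proj.
Proof. by rewrite linearB /= trmx1 trmx_mul trmxK. Qed.

Lemma dot_unit_col : unit_col^T *m unit_col = 1%:M.
Proof.
apply/matrixP => i j; rewrite mxE (bigD1 k) //= [unit_col^T _ _]mxE !unit_colE eqxx.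
rewrite big1 ?addr0 => [|l /negPf lk]; first by rewrite mxE !ord1 mulr1.
by rewrite unit_colE lk mulr0.
Qed.

Lemma dot_unit_coll (z : 'cV[int]_n) : unit_col^T *m z = (z k 0)%:M.
Proof.
apply/matrixP => i j; rewrite mxE (bigD1 k) //= [unit_col^T _ _]mxE !unit_colE eqxx.
rewrite big1 ?addr0 => [|l /negPf lk]; first by rewrite mxE !ord1 mul1r.
by rewrite [unit_col^T _ _]mxE unit_colE lk mul0r.
Qed.

Lemma dot_unit_colr (z : 'cV[int]_n) : z^T *m unit_col = (z k 0)%:M.
Proof. by rewrite -[LHS]trmxK trmx_mul trmxK dot_unit_coll tr_scalar_mx. Qed.

Lemma det_coord_proj : \det coord_proj = 0.
Proof.
rewrite (expand_det_row _ k) big1 // => j _; rewrite coord_projE eqxx mul1r eq_sym.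
by rewrite subrr mul0r.
Qed.

(** Both products of the adjugate with the singular [coord_proj] vanish, which kills every entry
    outside position [(k, k)]; the remaining one is the determinant of an identity block. *)
Lemma adj_coord_proj : \adj coord_proj = delta_mx k k.
Proof.
have D0l : coord_proj *m \adj coord_proj = 0 by rewrite mul_mx_adj det_coord_proj raddf0.
have D0r : \adj coord_proj *m coord_proj = 0 by rewrite mul_adj_mx det_coord_proj raddf0.
apply/matrixP => i j; rewrite [RHS]mxE.
have [ik|ik] /= := eqVneq i k; last first.
  have := congr1 (fun A : 'M_n => A i j) D0l; rewrite /= mxE (bigD1 i) //=.
  rewrite coord_projE eqxx (negPf ik) mul0r subr0 mul1r big1 ?addr0 => [|l li].
    by rewrite mxE [RHS]mxE.
  by rewrite coord_projE eq_sym (negPf li) (negPf ik) mul0r subr0 mul0r.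
have [jk|jk] /= := eqVneq j k; last first.
  have := congr1 (fun A : 'M_n => A i j) D0r; rewrite /= mxE (bigD1 j) //=.
  rewrite coord_projE eqxx (negPf jk) mulr0 subr0 mulr1 big1 ?addr0 => [|l li].
    by rewrite mxE [RHS]mxE.
  by rewrite coord_projE (negPf li) (negPf jk) mulr0 subr0 mulr0.
rewrite ik jk mxE cofactor_eq1 // => a b ak _.
by rewrite coord_projE (negPf ak) mul0r subr0.
Qed.

Variable z : 'cV[int]_n.
Definition sqnorm_off : int := \sum_(i | i != k) z i 0 ^+ 2.

Lemma dot_zz : z^T *m z = (z k 0 ^+ 2 + sqnorm_off)%:M.
Proof.
apply/matrixP => i j; rewrite [RHS]mxE !ord1 eqxx mxE /sqnorm_off (bigD1 k) //=.
by rewrite mxE expr2; congr (_ + _); apply: eq_bigr => l _; rewrite mxE expr2.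
Qed.

(** The cross terms vanish because [coord_proj] annihilates [unit_col], which has norm 1. The
    determinant of the update is therefore a square. *)
Lemma coord_proj_update :
  coord_proj + z *m z^T = (coord_proj + z *m unit_col^T) *m (coord_proj + z *m unit_col^T)^T.
Proof.
rewrite linearD /= trmx_mul trmxK trmx_coord_proj.
have De : coord_proj *m unit_col = 0.
  by rewrite mulmxBl mul1mx -mulmxA dot_unit_col mulmx1 subrr.
have eD : unit_col^T *m coord_proj = 0.
  by rewrite mulmxBr mulmx1 mulmxA dot_unit_col mul1mx subrr.
have DD : coord_proj *m coord_proj = coord_proj.
  by rewrite {1}/coord_proj mulmxBl mul1mx -mulmxA eD mulmx0 subr0.
move: coord_proj De eD DD => D De eD DD.
rewrite mulmxDl !mulmxDr DD mulmxA De mul0mx addr0 -!mulmxA eD mulmx0 add0r.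
by rewrite [in RHS](mulmxA unit_col^T) dot_unit_col mul1mx.
Qed.

Lemma det_update : \det (coord_proj + z *m z^T) = z k 0 ^+ 2.
Proof.
rewrite coord_proj_update det_mulmx det_tr expr2.
suff -> : \det (coord_proj + z *m unit_col^T) = z k 0 by [].
have ME i j : (coord_proj + z *m unit_col^T) i j =
    (i == j)%:R - (i == k)%:R * (j == k)%:R + z i 0 * (j == k)%:R.
  by rewrite mxE coord_projE mxE big_ord1 [unit_col^T _ _]mxE unit_colE.
rewrite (expand_det_row _ k) (bigD1 k) //= big1 ?addr0 => [|j jk].
  rewrite cofactor_eq1 => [|i j ik jk]; first by rewrite ME eqxx !mulr1 subrr add0r.
  by rewrite ME (negPf ik) (negPf jk) !mulr0 subr0 addr0.
by rewrite ME eqxx eq_sym (negPf jk) !mulr0 subr0 addr0 mul0r.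
Qed.

(** The candidate [A] satisfies [B A = z k 0 ^+ 2], the determinant of [B]. Multiplying by [\adj B]
    gives the equation up to this nonzero factor, which cancels. *)
Lemma adj_update : z k 0 != 0 ->
  \adj (coord_proj + z *m z^T) =
    (z k 0 ^+ 2)%:M - z k 0 *: (z *m unit_col^T + unit_col *m z^T)
    + (1 + sqnorm_off + z k 0 ^+ 2) *: (unit_col *m unit_col^T).
Proof.
move=> nz; set B := coord_proj + _; set A := (X in _ = X).
have eA : unit_col^T *m A =
    (- z k 0) *: z^T + (1 + sqnorm_off + z k 0 ^+ 2) *: unit_col^T.
  rewrite /A !(mulmxDr, mulmxN) -!scalemxAr mulmxDr !mulmxA dot_unit_coll dot_unit_col.
  rewrite !mul_scalar_mx mul_mx_scalar.
  by apply/matrixP => i j; rewrite !mxE; ring.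
have zA : z^T *m A = z k 0 *: unit_col^T.
  rewrite /A !(mulmxDr, mulmxN) -!scalemxAr mulmxDr !mulmxA dot_zz dot_unit_colr.
  rewrite !mul_scalar_mx mul_mx_scalar.
  by apply/matrixP => i j; rewrite !mxE; ring.
have BA : B *m A = (z k 0 ^+ 2)%:M.
  rewrite /B /coord_proj !mulmxDl mul1mx mulNmx -!mulmxA eA zA !(mulmxDr, mulmxN).
  rewrite -!scalemxAr /A.
  by apply/matrixP => i j; rewrite !(mxE, big_ord1); ring.
have : \adj B *m (B *m A) = (z k 0 ^+ 2) *: A.
  by rewrite mulmxA mul_adj_mx det_update mul_scalar_mx.
rewrite BA mul_mx_scalar => eqA; apply/matrixP => i j.
have := congr1 (fun M : 'M_n => M i j) eqA; rewrite /= [LHS]mxE [RHS]mxE.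
by apply: mulfI; rewrite expf_neq0.
Qed.

End RankOneUpdate.

(** Modulo 2 the matrices [B] and [B - 2 K] coincide, so an odd principal minor of the first forces
    the same minor of the second to be odd. *)
Lemma adj_shift2_neq0 n (B K : 'M[int]_n) k :
  (\adj B k k)%:~R != 0 :> 'F_2 -> \adj (B + (-2) *: K) k k != 0.
Proof.
apply: contra_neq => adj0.
have two0 : (-2)%:~R = 0 :> 'F_2 by apply/val_inj.
have eqB : map_mx (intmul (1 : 'F_2)) B = map_mx (intmul 1) (B + (-2) *: K).
  by apply/matrixP => i j; rewrite !mxE intrD intrM two0 mul0r addr0.
have -> : (\adj B k k)%:~R = (map_mx (intmul (1 : 'F_2)) (\adj B)) k k.
  by rewrite [RHS]mxE.
by rewrite map_mx_adj eqB -map_mx_adj [LHS]mxE adj0.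
Qed.

(** * Values and derivatives of pencils at 0 and -2 *)

Section Pencils.
Variables (n : nat) (k : 'I_n) (L : 'M[int]_n).
Hypothesis uL : L \in unitmx.
Let K := L *m L^T.

(** The derivative at -2 is the trace of [L L^T] against the adjugate of the singular symmetric
    matrix [B - 2 K], whose [(k, k)] minor is nonzero by parity. *)
Lemma pencil_simple_root (B : 'M[int]_n) :
  B^T = B -> (\adj B k k)%:~R != 0 :> 'F_2 ->
  root (pencil B K) (-2) -> (pencil B K)^`().[-2] != 0.
Proof.
move=> symB oddB; rewrite /root horner_pencil => /eqP det0.
rewrite horner_deriv_pencil (tr_mul_adj_neq0 (k := k)) // ?adj_shift2_neq0 //.
by rewrite linearD linearZ /= symB trmx_mul trmxK.
Qed.

Lemma pencil_tree :
  [/\ (pencil (coord_proj k) K).[0] = 0, (pencil (coord_proj k) K)^`().[0] = K k k &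
      root (pencil (coord_proj k) K) (-2) -> (pencil (coord_proj k) K)^`().[-2] != 0].
Proof.
rewrite horner_pencil horner_deriv_pencil scale0r addr0 det_coord_proj adj_coord_proj.
split=> //; last first.
  by apply: pencil_simple_root; rewrite ?trmx_coord_proj // adj_coord_proj mxE eqxx.
rewrite /mxtrace (bigD1 k) //= big1 ?addr0 => [|i ik].
  rewrite mxE (bigD1 k) //= big1 ?addr0 => [|i ik].
    by rewrite [delta_mx _ _ _ _]mxE !eqxx mulr1.
  by rewrite [delta_mx _ _ _ _]mxE (negPf ik) mulr0.
rewrite mxE big1 // => j _.
by rewrite [delta_mx _ _ _ _]mxE (negPf ik) andbF mulr0.
Qed.

(** With [u = unit_col k], the adjugate is [4 - 2 e (z u^T + u z^T) + (5 + 2 q) u u^T]. Its trace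
    against [K] is [(1 + 2 q) K k k] modulo 4, and its [(k, k)] entry is [1 + 2 q], which is odd. *)
Lemma pencil_unicyclic (z : 'cV[int]_n) (e q : int) :
  e ^+ 2 = 1 -> z k 0 = 2 * e -> sqnorm_off k z = 2 * q ->
  let psi := pencil (coord_proj k + z *m z^T) K in
  [/\ psi.[0] = 4, exists c, psi^`().[0] = (1 + 2 * q) * K k k + 4 * c &
      root psi (-2) -> psi^`().[-2] != 0].
Proof.
move=> e2 zk a2 psi.
have nz_zk : z k 0 != 0.
  by rewrite zk mulf_neq0 //; apply: contra_eq_neq e2 => ->; rewrite expr0n.
have zk2 : z k 0 ^+ 2 = 4 by rewrite zk exprMn e2.
have adjE := adj_update nz_zk; rewrite zk2 a2 zk in adjE.
have symB : (coord_proj k + z *m z^T)^T = coord_proj k + z *m z^T.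
  by rewrite linearD /= trmx_coord_proj trmx_mul trmxK.
split; first by rewrite horner_pencil scale0r addr0 det_update zk2.
  rewrite horner_deriv_pencil scale0r addr0 adjE.
  set w := \tr (K *m (z *m (unit_col k)^T)).
  (* Both mixed terms have the same trace since [K] is symmetric, so their common coefficient
     [2 * e] doubles to a multiple of 4. *)
  have trK1 : \tr (K *m (unit_col k *m z^T)) = w.
    by rewrite /w /K -mxtrace_tr !trmx_mul !trmxK mxtrace_mulC.
  have trK2 : \tr (K *m (unit_col k *m (unit_col k)^T)) = K k k.
    by rewrite mulmxA mxtrace_mulC dot_unit_coll mxtrace_scalar -colE mxE.
  exists (\tr K - e * w + K k k).
  rewrite mulmxDr mulmxBr mul_mx_scalar -!scalemxAr mulmxDr.
  rewrite mxtraceD raddfB /= !mxtraceZ mxtraceD -/w trK1 trK2.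
  by ring.
apply: pencil_simple_root => //; rewrite adjE !mxE !big_ord1 !mxE !eqxx zk.
rewrite /= ?mulr1n [X in X%:~R](_ : _ = 1 + 2 * (q + 4 - 4 * e ^+ 2)); last by ring.
by rewrite e2 intrD intrM (_ : 2%:~R = 0 :> 'F_2) ?mul0r //; apply/val_inj.
Qed.

End Pencils.

(** * Spanning trees *)

(** An entry of D + A over the integers, for a bare relation on any finite type, so that it serves
    for vertices and for ordinals alike. *)
Definition qent (T : finType) (e : rel T) (x y : T) : int :=
  (x == y)%:R * (\sum_z (e x z)%:R) + (e x y)%:R.

Lemma sqr_unitz (x : int) : x \is a GRing.unit -> x ^+ 2 = 1.
Proof. by case/orP=> /eqP ->. Qed.

(** Factoring [N] and [N^T] out of [N B N^T + X] costs the square of the determinant of [N], which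
    is 1 because [N] is unimodular. *)
Lemma pencil_congr n (N B : 'M[int]_n) :
  N \in unitmx -> pencil (N *m B *m N^T) 1%:M = pencil B (invmx N *m (invmx N)^T).
Proof.
move=> uN; set L := invmx N.
have NK : N *m (L *m L^T) *m N^T = 1%:M.
  by rewrite mulmxA mulmxV // mul1mx -trmx_mul mulmxV // trmx1.
rewrite -NK /pencil !map_mxM /= scalemxAl scalemxAr.
rewrite -mulmxDl -mulmxDr !det_mulmx !det_map_mx det_tr mulrAC -expr2 -rmorphXn /=.
by rewrite sqr_unitz ?mul1r // -unitmxE.
Qed.

(** Breadth-first search: [h x] is the least length of a path from [r] to [x], and the parent of [x]
    is the penultimate vertex of a shortest path. *)
Lemma spanning_tree (T : finType) (e : rel T) (r : T) :
    symmetric e -> (forall x, connect e r x) ->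
  exists p : T -> T, exists h : T -> nat,
    forall x, x != r -> e x (p x) && (h (p x) < h x)%N.
Proof.
move=> sym_e conn.
pose P x k := [exists t : k.-tuple T, path e r t && (last r t == x)].
have exP x : exists k, P x k.
  have /connectP [s es ->] := conn x; exists (size s).
  by apply/existsP; exists (in_tuple s); rewrite es eqxx.
pose h x := ex_minn (exP x).
have parent x : exists y, (x != r) ==> (e x y && (h y < h x)%N).
  have [xr|] := eqVneq x r; first by exists r.
  rewrite /h; case: (ex_minnP (exP x)) => k /existsP [t /andP [et /eqP <-]] _ xr.
  move: (size_tuple t); case/lastP: (tval t) et xr => [|s y]; first by rewrite eqxx.
  rewrite rcons_path last_rcons size_rcons => /andP[es ey] _ <-.
  exists (last r s); rewrite sym_e ey /=; case: ex_minnP => m _; rewrite ltnS; apply.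
  by apply/existsP; exists (in_tuple s); rewrite es eqxx.
have [p pP] := fin_all_exists parent.
by exists p, h => x xr; have := pP x; rewrite xr.
Qed.

Section SpanningTree.
Variables (n : nat) (e : rel 'I_n) (r : 'I_n) (p : 'I_n -> 'I_n) (h : 'I_n -> nat).
Hypotheses (sym_e : symmetric e) (irr_e : irreflexive e).
Hypothesis treeP : forall x, x != r -> e x (p x) && (h (p x) < h x)%N.

(** Column [j != r] is the incidence vector of the tree edge from [j] to its parent. The root gets a
    unit vector, which makes the matrix square and unimodular. *)
Definition inc_mx : 'M[int]_n :=
  \matrix_(i, j) ((i == j)%:R + (j != r)%:R * (i == p j)%:R).

Lemma tree_ind (P : 'I_n -> Prop) :
  P r -> (forall x, x != r -> P (p x) -> P x) -> forall x, P x.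
Proof.
move=> Pr Pp x; have [m] := ubnP (h x); elim: m x => // m IHm x /ltnSE hx.
have [->//|xr] := eqVneq x r; apply: (Pp _ xr); apply: IHm.
by have /andP[_ /leq_trans] := treeP xr; apply.
Qed.

(** Unit vectors are reached along the tree: column [r] is the one at the root, and the one at [x]
    is column [x] minus the one at [p x]. *)
Lemma inc_mx_unit : inc_mx \in unitmx.
Proof.
have solve x : exists c : 'cV[int]_n, inc_mx *m c = delta_mx x 0.
  have colN j : inc_mx *m delta_mx j 0 =
      delta_mx j 0 + (j != r)%:R *: delta_mx (p j) 0 :> 'cV[int]_n.
    by rewrite -colE; apply/matrixP => i k; rewrite !mxE ord1 !andbT.
  elim/tree_ind: x => [|x xr [c cE]].
    by exists (delta_mx r 0); rewrite colN eqxx scale0r addr0.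
  exists (delta_mx x 0 - c).
  by rewrite mulmxBr colN cE xr scale1r addrK.
have [c cE] := fin_all_exists solve.
suff /mulmx1_unit [] : inc_mx *m (\matrix_(i, j) c j i 0) = 1%:M by [].
apply/matrixP => i j; rewrite [RHS]mxE.
have := congr1 (fun A : 'cV_n => A i 0) (cE j); rewrite /= [RHS]mxE andbT => <-.
by rewrite !mxE; apply: eq_bigr => k _; rewrite [X in _ * X]mxE.
Qed.

Let L := invmx inc_mx.
(** The root row of the inverse is the proper 2-colouring of the tree by signs, with value 1 at the
    root. *)
Definition tree_sign x : int := L r x.

Lemma tree_signE j : tree_sign j + (j != r)%:R * tree_sign (p j) = (r == j)%:R.
Proof.
have := congr1 (fun A : 'M_n => A r j) (mulVmx inc_mx_unit).
rewrite /= [RHS]mxE => <-; rewrite mxE.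
under eq_bigr => k _ do rewrite [inc_mx _ _]mxE mulrDr.
rewrite big_split /=; congr (_ + _).
  rewrite (bigD1 j) //= eqxx mulr1 big1 ?addr0 // => k /negPf ->.
  by rewrite mulr0.
rewrite (bigD1 (p j)) //= eqxx mulr1 big1 ?addr0 => [|k /negPf ->].
  by rewrite mulrC.
by rewrite !mulr0.
Qed.

Lemma tree_sign_root : tree_sign r = 1.
Proof. by have := tree_signE r; rewrite eqxx mul0r addr0. Qed.

Lemma tree_sign_parent x : x != r -> tree_sign x = - tree_sign (p x).
Proof.
move=> xr; have := tree_signE x; rewrite xr mul1r eq_sym (negPf xr) => /eqP.
by rewrite addr_eq0 => /eqP.
Qed.

Lemma sqr_tree_sign x : tree_sign x ^+ 2 = 1.
Proof.
elim/tree_ind: x => [|x xr IHx]; first by rewrite tree_sign_root.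
by rewrite tree_sign_parent // sqrrN.
Qed.

(** Row [r] of [L] consists of signs, so its squared norm counts the vertices. This is how the order
    enters the derivative at 0. *)
Lemma tree_gram_root : (L *m L^T) r r = n%:R.
Proof.
rewrite mxE (eq_bigr (fun=> 1)) ?sumr_const ?card_ord // => k _.
by rewrite [L^T _ _]mxE -expr2 sqr_tree_sign.
Qed.

Definition tree_rel : rel 'I_n :=
  fun i j => (i != r) && (j == p i) || (j != r) && (i == p j).

Lemma tree_rel_sym : symmetric tree_rel.
Proof. by move=> i j; rewrite /tree_rel orbC. Qed.

Lemma sub_tree_rel i j : tree_rel i j -> e i j.
Proof.
by case/orP=> /andP [/treeP/andP[? _] /eqP ->] //; rewrite sym_e.
Qed.

Lemma sum_tree_rel (F : 'I_n -> 'I_n -> int) :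
    (forall i j, F i j = F j i) ->
  \sum_i \sum_(j | tree_rel i j) F i j = 2 * \sum_(i | i != r) F i (p i).
Proof.
move=> symF.
have up : \sum_i \sum_(j | (i != r) && (j == p i)) F i j
          = \sum_(i | i != r) F i (p i).
  rewrite [RHS]big_mkcond; apply: eq_bigr => i _.
  by case: ifP => _; rewrite ?big_pred0_eq ?big_pred1_eq.
have down : \sum_i \sum_(j | (j != r) && (i == p j)) F i j
            = \sum_(i | i != r) F i (p i).
  rewrite (exchange_big_dep xpredT) //= -up; apply: eq_bigr => i _.
  by apply: eq_bigr => j _; rewrite symF.
rewrite mulrDl mul1r -{1}up -down -big_split /=; apply: eq_bigr => i _.
rewrite big_mkcond [X in _ = X + _]big_mkcond [X in _ = _ + X]big_mkcond.
rewrite -big_split /=; apply: eq_bigr => j _; rewrite /tree_rel.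
(* An ordered pair cannot go both from child to parent and from parent to child, since [h] would
   decrease both ways. *)
have excl : (i != r) && (j == p i) -> (j != r) && (i == p j) -> false.
  case/andP=> /treeP/andP[_ lt_i] /eqP jE /andP[/treeP/andP[_ lt_j] /eqP iE].
  rewrite -jE in lt_i; rewrite -iE in lt_j.
  by rewrite -[false](ltnn (h i)) (ltn_trans lt_j).
move: excl; case: (_ && _); case: (_ && _) => excl /=; rewrite ?addr0 ?add0r //.
by have := excl isT isT.
Qed.

Definition rest_rel : rel 'I_n := fun i j => e i j && ~~ tree_rel i j.

Lemma rest_rel_sym : symmetric rest_rel.
Proof. by move=> i j; rewrite /rest_rel sym_e tree_rel_sym. Qed.

Lemma sum_rel_split (F : 'I_n -> 'I_n -> int) :
    (forall i j, F i j = F j i) ->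
  \sum_i \sum_(j | e i j) F i j =
    2 * (\sum_(i | i != r) F i (p i)) + \sum_(q | rest_rel q.1 q.2) F q.1 q.2.
Proof.
move=> symF; rewrite -sum_tree_rel //.
rewrite -(pair_big_dep xpredT (fun i j => rest_rel i j) (fun i j => F i j)) -big_split.
apply: eq_bigr => i _; rewrite (bigID (tree_rel i)) /=; congr (_ + _).
by apply: eq_bigl => j; rewrite andb_idl //; apply: sub_tree_rel.
Qed.

Definition inc_ent (a b i : 'I_n) : int := (i == a)%:R + (i == b)%:R.

Lemma sum_delta (f : 'I_n -> int) i : \sum_a (i == a)%:R * f a = f i.
Proof.
rewrite (bigD1 i) //= eqxx mul1r big1 ?addr0 // => a /negPf ai.
by rewrite eq_sym ai mul0r.
Qed.

(** The signless Laplacian is the sum, over the edges, of the outer squares of their incidence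
    vectors; the factor 2 comes from summing over ordered pairs. *)
Lemma qent_sum i j :
  2 * qent e i j = \sum_a \sum_(b | e a b) inc_ent a b i * inc_ent a b j.
Proof.
transitivity (\sum_a \sum_b ((i == a)%:R * ((j == a)%:R * (e a b)%:R)
    + (i == b)%:R * ((j == b)%:R * (e a b)%:R)
    + ((i == a)%:R * ((j == b)%:R * (e a b)%:R)
    + (i == b)%:R * ((j == a)%:R * (e a b)%:R))) : int); last first.
  apply: eq_bigr => a _; rewrite [RHS]big_mkcond; apply: eq_bigr => b _.
  rewrite /inc_ent; case: (e a b); last by rewrite !mulr0 !addr0.
  by rewrite !mulr1; ring.
have symR a b : (e a b)%:R = (e b a)%:R :> int by rewrite sym_e.
under eq_bigr => a _ do rewrite !big_split /=.
rewrite !big_split /= ![\sum_i0 \sum_b (i == b)%:R * _]exchange_big /=.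
under eq_bigr => a _ do rewrite -mulr_sumr.
under [X in _ + X + _]eq_bigr => a _ do rewrite -mulr_sumr.
under [X in _ + (X + _)]eq_bigr => a _ do rewrite -mulr_sumr.
under [X in _ + (_ + X)]eq_bigr => a _ do rewrite -mulr_sumr.
rewrite !sum_delta -!mulr_sumr /qent.
under [X in _ + _ * X + _]eq_bigr => a _ do rewrite symR.
by rewrite (symR j) [j == i]eq_sym; ring.
Qed.

Lemma inc_mx_col i k : k != r -> inc_mx i k = inc_ent k (p k) i.
Proof. by move=> kr; rewrite mxE kr mul1r. Qed.

Lemma tree_gram_ent i j : (inc_mx *m coord_proj r *m inc_mx^T) i j =
  \sum_(k | k != r) inc_ent k (p k) i * inc_ent k (p k) j.
Proof.
have MD k : (inc_mx *m coord_proj r) i k = (k != r)%:R * inc_mx i k.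
  rewrite mxE; under eq_bigr => a _ do rewrite coord_projE mulrC mulrBl eq_sym -mulrA.
  rewrite sumrB sum_delta; under eq_bigr => a _ do rewrite eq_sym.
  rewrite sum_delta; case: (k == r) / eqP => [->|_].
    by rewrite mul1r mul0r subrr.
  by rewrite mul0r mul1r subr0.
rewrite mxE [RHS]big_mkcond; apply: eq_bigr => k _.
rewrite MD [inc_mx^T _ _]mxE.
by case: ifP => kr; rewrite ?mul0r // mul1r !inc_mx_col ?kr.
Qed.

Let Q := \matrix_(i, j) qent e i j.
Let T := inc_mx *m coord_proj r *m inc_mx^T.

Lemma Qmx_sum i j : 2 * Q i j = 2 * T i j +
  \sum_(q | rest_rel q.1 q.2) inc_ent q.1 q.2 i * inc_ent q.1 q.2 j.
Proof.
rewrite [Q i j]mxE qent_sum sum_rel_split ?tree_gram_ent // => a b.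
by rewrite /inc_ent ![_ + (_ == b)%:R]addrC.
Qed.

Definition deg_sum : int := \sum_i \sum_j (e i j)%:R.

(** The tree takes up [2 * n - 2] of the ordered adjacent pairs, so the number of remaining pairs
    separates trees, unicyclic graphs and denser ones. *)
Lemma deg_sum_split : deg_sum + 2 = 2 * n%:R + #|[pred q | rest_rel q.1 q.2]|%:R.
Proof.
have -> : deg_sum = \sum_i \sum_(j | e i j) 1.
  apply: eq_bigr => i _; rewrite [RHS]big_mkcond.
  by apply: eq_bigr => j _; case: (e i j).
have nE : n%:R = #|predC1 r|%:R + 1 :> int.
  rewrite natr1; congr (_%:R); rewrite -[LHS]card_ord (cardD1 r) inE; congr _.+1.
  by apply: eq_card => i; rewrite !inE andbT.
by rewrite sum_rel_split // !sumr_const nE; ring.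
Qed.

Let psi := pencil Q 1%:M.

(** With no edge off the tree, [Q] is congruent to [coord_proj r]. One such edge [uv] adds a
    rank-one term [z z^T], where [z r 0] is the sum of the signs of [u] and [v]: it is 0 if the
    cycle is even, and 2 or -2 if it is odd. More edges give the last case. *)
Lemma component_cases :
  [\/ [/\ deg_sum + 2 = 2 * n%:R, psi.[0] = 0, psi^`().[0] = n%:R
        & root psi (-2) -> psi^`().[-2] != 0],
      [/\ deg_sum = 2 * n%:R, psi.[0] = 4,
          exists q c, psi^`().[0] = (1 + 2 * q) * n%:R + 4 * c
        & root psi (-2) -> psi^`().[-2] != 0],
      [/\ deg_sum = 2 * n%:R, psi.[0] = 0
        & exists s : 'I_n -> bool, forall a b, e a b -> s a != s b]
    | 2 * n%:R < deg_sum].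
Proof.
have := deg_sum_split; have := Qmx_sum.
case: (pickP [pred q | rest_rel q.1 q.2]) => [[u v] /= uv|rest0]; last first.
  rewrite eq_card0 // addr0 => QE dE; apply: Or41.
  have -> : psi = pencil (coord_proj r) (L *m L^T).
    rewrite /psi -pencil_congr ?inc_mx_unit //; congr (pencil _ _).
    apply/matrixP => i j; apply: (@mulfI _ 2) => //.
    by rewrite QE big_pred0 // addr0.
  have [psi0 dpsi0 simple] := pencil_tree r (etrans (unitmx_inv _) inc_mx_unit).
  by split=> //; rewrite dpsi0 tree_gram_root.
have vu : rest_rel v u by rewrite rest_rel_sym.
have uv_neq : (v, u) != (u, v).
  by apply: contraTneq uv => -[_ ->]; rewrite /rest_rel irr_e.
rewrite (cardD1 (u, v)) (cardD1 (v, u)) !inE /= uv vu uv_neq.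
set k := #|_|; have [k0|k_gt0] := posnP k; last first.
  by move=> _ dE; apply: Or44; lia.
rewrite k0 !addn0 => QE dE.
have {}dE : deg_sum = 2 * n%:R by lia.
have only i j : rest_rel i j -> (i, j) = (u, v) \/ (i, j) = (v, u).
  move=> ij; have := card0_eq k0 (i, j); rewrite !inE /= ij andbT.
  by case: eqP => [->|_]; [right|case: eqP => // ->; left].
pose w : 'cV[int]_n := \col_i inc_ent u v i; pose z := L *m w.
have Nz : inc_mx *m z = w by rewrite mulmxA mulmxV ?inc_mx_unit // mul1mx.
have zr : z r 0 = tree_sign u + tree_sign v.
  rewrite mxE; under eq_bigr => i _ do rewrite mxE mulrC mulrDl.
  rewrite big_split /=; congr (_ + _).
    by under eq_bigr => i _ do rewrite eq_sym; rewrite sum_delta.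
  by under eq_bigr => i _ do rewrite eq_sym; rewrite sum_delta.
clearbody z.
have psiE : psi = pencil (coord_proj r + z *m z^T) (L *m L^T).
  rewrite /psi -pencil_congr ?inc_mx_unit //; congr (pencil _ _).
  have zzE : inc_mx *m (z *m z^T) *m inc_mx^T = w *m w^T.
    by rewrite -Nz trmx_mul !mulmxA.
  rewrite mulmxDr mulmxDl zzE.
  apply/matrixP => i j; apply: (@mulfI _ 2) => //.
  rewrite QE (bigD1 (u, v)) //= (bigD1 (v, u)) ?vu //= big1 ?addr0; last first.
    move=> [a b] /= /andP[/andP[/only ab ne1] ne2].
    by case: ab ne1 ne2 => -> //; rewrite eqxx.
  have -> : (T + w *m w^T) i j = T i j + inc_ent u v i * inc_ent u v j.
    rewrite [LHS]mxE [X in _ + X]mxE big_ord1 [w^T _ _]mxE.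
    by rewrite !(mxE _ (fun i _ => inc_ent u v i)).
  by rewrite /inc_ent; ring.
have signP x : tree_sign x = 1 \/ tree_sign x = -1.
  by have /eqP := sqr_tree_sign x; rewrite sqrf_eq1 => /orP[] /eqP; auto.
have [zr0|zr_neq0] := eqVneq (z r 0) 0.
  apply: Or43; split=> //.
    by rewrite psiE horner_pencil scale0r addr0 det_update zr0 expr0n.
  (* Signs alternate along tree edges, and here they also differ at the ends [u], [v] of the extra
     edge, so they colour the whole graph properly. *)
  exists (fun x => tree_sign x == 1) => a b ab.
  suff -> : tree_sign a = - tree_sign b by case: (signP b) => ->.
  have [/orP[]/andP[xr /eqP xE]|ntree] := boolP (tree_rel a b).
  - by rewrite xE tree_sign_parent.
  - by rewrite xE (tree_sign_parent xr) opprK.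
  have opp : tree_sign u = - tree_sign v by apply/eqP; rewrite -addr_eq0 -zr zr0.
  have [[-> ->]|[-> ->]] := only a b (introT andP (conj ab ntree)); first by [].
  by rewrite opp opprK.
pose eps := tree_sign u.
have zr2 : z r 0 = 2 * eps.
  rewrite zr /eps in zr_neq0 *.
  by case: (signP u) (signP v) zr_neq0 => -> [] ->; rewrite ?subrr ?addNr.
(* [pencil_unicyclic] needs [sqnorm_off r z] to be even. Summing the rows of [inc_mx *m z = w] gives
   [z r 0 + 2 * S = 2], because column [r] has sum 1 and the others have sum 2. Hence [S = 1 - eps]
   is even, and squares have the parity of their bases. *)
pose S := \sum_(j | j != r) z j 0.
have S_eps : S = 1 - eps.
  have : \sum_i (inc_mx *m z) i 0 = 2.
    rewrite Nz (eq_bigr (fun i => (i == u)%:R * 1 + (i == v)%:R * 1)).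
      rewrite big_split /=.
      under eq_bigr => i _ do rewrite eq_sym.
      under [X in _ + X]eq_bigr => i _ do rewrite eq_sym.
      by rewrite (sum_delta (fun=> 1)) (sum_delta (fun=> 1)).
    by move=> i _; rewrite mxE !mulr1.
  under eq_bigr => i _ do rewrite mxE.
  rewrite exchange_big /=.
  have colsum j : \sum_i inc_mx i j * z j 0 = z j 0 + (j != r)%:R * z j 0.
    under eq_bigr => i _ do rewrite mxE mulrDl -mulrA mulrCA eq_sym [i == p j]eq_sym.
    by rewrite big_split /= (sum_delta (fun=> z j 0)) (sum_delta (fun=> _ * z j 0)).
  under eq_bigr => j _ do rewrite colsum.
  rewrite big_split /= (bigD1 r) //= -/S zr2.
  have -> : \sum_i (i != r)%:R * z i 0 = S.
    rewrite /S [RHS]big_mkcond; apply: eq_bigr => i _.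
    by case: ifP => _; rewrite ?mul1r ?mul0r.
  by lia.
have [c sqE] : exists c, sqnorm_off r z = S + 2 * c.
  have sq (x : int) : exists c, x ^+ 2 = x + 2 * c.
    have [m [] ->] : exists m, x = 2 * m \/ x = 2 * m + 1.
    - by exists (x %/ 2)%Z; lia.
    - by exists (2 * m ^+ 2 - m); ring.
    - by exists (2 * m ^+ 2 + m); ring.
  have [c cE] := fin_all_exists (fun i => sq (z i 0)).
  exists (\sum_(i | i != r) c i); rewrite mulr_sumr -big_split /=.
  by apply: eq_bigr => i _.
have [q qE] : exists q, sqnorm_off r z = 2 * q.
  rewrite sqE S_eps /eps; case: (signP u) => ->.
    by exists c; rewrite subrr add0r.
  by exists (1 + c); ring.
apply: Or42; split=> //.
all: have [psi0 dpsi0 simple] := pencil_unicyclic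
  (etrans (unitmx_inv _) inc_mx_unit) (sqr_tree_sign u) zr2 qE.
- by rewrite psiE.
- by have [c' psi'E] := dpsi0; exists q, c'; rewrite psiE psi'E tree_gram_root.
- by rewrite psiE.
Qed.

End SpanningTree.

(** * The signless Laplacian polynomial *)

Lemma det_mxsub_bij (R : comNzRingType) m n (f : 'I_m -> 'I_n) (A : 'M[R]_n) :
  bijective f -> \det (mxsub f f A) = \det A.
Proof.
move=> bij_f; have eq_mn : m = n by rewrite -[m]card_ord -[n]card_ord (bij_eq_card bij_f).
subst m; pose s := perm.perm (bij_inj bij_f).
have -> : mxsub f f A = row_perm s (col_perm s A).
  by apply/matrixP => i j; rewrite !mxE !perm.permE.
rewrite row_permE col_permE !det_mulmx -tr_perm_mx det_tr det_perm.
by rewrite mulrCA -expr2 sqrr_sign mulr1.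
Qed.

Lemma pencil1_char_poly (R : comNzRingType) n (A : 'M[R]_n) :
  pencil A 1%:M = char_poly (- A).
Proof.
congr (\det _); apply/matrixP => i j.
rewrite !mxE polyCN opprK addrC.
by case: (i == j); rewrite ?mulr1 // ?mulr0.
Qed.

Definition Qmat (G : sgraph) : 'M[int]_#|G| :=
  \matrix_(i, j) qent adj (enum_val i) (enum_val j).

(* By this sign convention all coefficients are nonnegative: the roots are the
   opposites of the eigenvalues. *)
Definition Qpoly (G : sgraph) : {poly int} := pencil (Qmat G) 1%:M.

Definition degree_sum (G : sgraph) : int := \sum_(x : G) \sum_(y : G) (adj x y)%:R.

Lemma size_Qpoly (G : sgraph) : size (Qpoly G) = #|G|.+1.
Proof. by rewrite /Qpoly pencil1_char_poly size_char_poly. Qed.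

Lemma monic_Qpoly (G : sgraph) : Qpoly G \is monic.
Proof. by rewrite /Qpoly pencil1_char_poly char_poly_monic. Qed.

Lemma tr_Qmat (G : sgraph) : \tr (Qmat G) = degree_sum G.
Proof.
rewrite /mxtrace /degree_sum (reindex (@enum_val G predT)) /=; last first.
  by apply: onW_bij; apply: enum_val_bij.
by apply: eq_bigr => i _; rewrite mxE /qent eqxx mul1r adj_irrefl addr0.
Qed.

Lemma coef_Qpoly_degree_sum (G : sgraph) :
  (0 < #|G|)%N -> (Qpoly G)`_#|G|.-1 = degree_sum G.
Proof.
move=> G_gt0; rewrite /Qpoly pencil1_char_poly char_poly_trace //.
by rewrite [\tr (- _)]raddfN /= opprK tr_Qmat.
Qed.

Lemma pencil1_mxsub m n (f : 'I_m -> 'I_n) (A : 'M[int]_n) :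
  bijective f -> pencil (mxsub f f A) 1%:M = pencil A 1%:M.
Proof.
move=> bij_f; rewrite /pencil -(det_mxsub_bij _ bij_f); congr (\det _).
by apply/matrixP => i j; rewrite !mxE (inj_eq (bij_inj bij_f)).
Qed.

(** Reindexing conjugates by a permutation, so any enumeration of the vertices may be used. *)
Lemma Qpoly_along (G : sgraph) m (f : 'I_m -> G) : bijective f ->
  pencil (\matrix_(i, j) qent adj (f i) (f j)) 1%:M = Qpoly G.
Proof.
move=> bij_f; rewrite /Qpoly -(@pencil1_mxsub _ _ (enum_rank \o f)).
  by congr (pencil _ _); apply/matrixP => i j; rewrite !mxE /= !enum_rankK.
exact: bij_comp (enum_rank_bij _) bij_f.
Qed.

Section Isomorphism.
Variables (G H : sgraph) (f : G -> H).
Hypotheses (bij_f : bijective f) (adj_f : forall x y, adj (f x) (f y) = adj x y).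

Lemma sum_bij (F : H -> int) : \sum_y F y = \sum_x F (f x).
Proof. by rewrite (reindex f) //=; apply: onW_bij. Qed.

Lemma qent_bij x y : qent adj (f x) (f y) = qent adj x y.
Proof.
rewrite /qent (inj_eq (bij_inj bij_f)) adj_f sum_bij.
by congr (_ * _ + _); apply: eq_bigr => z _; rewrite adj_f.
Qed.

Lemma Qpoly_bij : Qpoly G = Qpoly H.
Proof.
rewrite -(Qpoly_along (bij_comp bij_f (enum_val_bij G))) /Qpoly.
by congr (pencil _ _); apply/matrixP => i j; rewrite !mxE /= qent_bij.
Qed.

Lemma degree_sum_bij : degree_sum G = degree_sum H.
Proof.
rewrite [RHS]/degree_sum sum_bij; apply: eq_bigr => x _; rewrite sum_bij.
by apply: eq_bigr => y _; rewrite adj_f.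
Qed.

End Isomorphism.

Lemma Qpoly_iso (G H : sgraph) : isomorphic G H -> Qpoly G = Qpoly H.
Proof. by case=> f [bij_f adj_f]; apply: Qpoly_bij adj_f. Qed.

Lemma degree_sum_iso (G H : sgraph) : isomorphic G H -> degree_sum G = degree_sum H.
Proof. by case=> f [bij_f adj_f]; apply: degree_sum_bij adj_f. Qed.

Lemma card_iso (G H : sgraph) : isomorphic G H -> #|G| = #|H|.
Proof. by case=> f [bij_f _]; apply: bij_eq_card bij_f. Qed.

Lemma sum_sum (A B : finType) (F : (A + B)%type -> int) :
  \sum_u F u = \sum_x F (inl x) + \sum_y F (inr y).
Proof. by rewrite big_sumType. Qed.

Lemma card_union (G H : sgraph) : #|disjoint_union G H| = (#|G| + #|H|)%N.
Proof. exact: card_sum. Qed.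

Lemma degree_sum_union (G H : sgraph) :
  degree_sum (disjoint_union G H) = degree_sum G + degree_sum H.
Proof.
rewrite /degree_sum sum_sum; congr (_ + _); apply: eq_bigr => x _; rewrite sum_sum /=.
  by rewrite [X in _ + X]big1 ?addr0.
by rewrite big1 ?add0r.
Qed.

Lemma Qpoly_union (G H : sgraph) : Qpoly (disjoint_union G H) = Qpoly G * Qpoly H.
Proof.
pose f (i : 'I_(#|G| + #|H|)) : disjoint_union G H :=
  match split i with inl a => inl (enum_val a) | inr b => inr (enum_val b) end.
have bij_f : bijective f.
  pose g (u : disjoint_union G H) : 'I_(#|G| + #|H|) :=
    match u with inl x => lshift _ (enum_rank x) | inr y => rshift _ (enum_rank y) end.
  exists g => [i|[x|y]]; rewrite /f /g.
  - by case: split_ordP => j ->; rewrite enum_valK.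
  - by rewrite (unsplitK (inl _)) enum_rankK.
  - by rewrite (unsplitK (inr _)) enum_rankK.
rewrite -(Qpoly_along bij_f).
rewrite [X in pencil X _](_ : _ = block_mx (Qmat G) 0 0 (Qmat H)).
  rewrite /pencil scalar_mx_block !map_block_mx scale_block_mx add_block_mx.
  by rewrite !map_mx0 !scaler0 !addr0 det_ublock.
apply/matrixP => i j; rewrite mxE /f.
case: (split_ordP i) => a ->; case: (split_ordP j) => b ->.
- rewrite block_mxEul mxE /qent sum_sum /= [X in _ * (_ + X)]big1 ?addr0 //.
- by rewrite block_mxEur mxE /qent mul0r.
- by rewrite block_mxEdl mxE /qent mul0r.
- by rewrite block_mxEdr mxE /qent sum_sum /= [X in _ * (X + _)]big1 ?add0r.
Qed.

Lemma comp_char_poly (G : sgraph) :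
  char_poly (Qmat G) \Po (- 'X) = (-1) ^+ #|G| * Qpoly G.
Proof.
rewrite /char_poly -[LHS](det_map_mx (comp_poly (- 'X))) /=.
rewrite /Qpoly /pencil -detZ; congr (\det _); apply/matrixP => i j.
rewrite !mxE raddfB /= comp_polyC raddfMn /= comp_polyX.
by case: (i == j); rewrite ?mulr1 ?mulr0 ?mulr1n ?mulr0n; ring.
Qed.

Lemma signless_laplacianE (G : sgraph) :
  signless_laplacian G = map_mx intr (Qmat G).
Proof.
apply/matrixP => i j; rewrite !mxE /qent (inj_eq enum_val_inj) rmorphD rmorphM /=.
rewrite !mulrz_nat; congr (_ + _).
have -> : (\sum_z (adj (enum_val i) z)%:R : int)%:~R = (degree (enum_val i))%:R :> algC.
  rewrite -natr_sum mulrz_nat /degree -sum1dep_card [in RHS]big_mkcond.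
  by congr (_%:R); apply: eq_bigr => z _; case: (adj _ z).
by case: eqP => _; rewrite ?mul1r ?mul0r.
Qed.

(** Since [int] embeds in [algC], the multiset of eigenvalues and the integer characteristic
    polynomial determine each other. Substituting [- 'X] leads to [Qpoly], up to a sign fixed by the
    order, which is read off the degree. *)
Lemma perm_QspectrumP (G H : sgraph) :
  perm_eq (Qspectrum G) (Qspectrum H) <-> Qpoly G = Qpoly H.
Proof.
have charE K : \prod_(a <- Qspectrum K) ('X - a%:P) = map_poly intr (char_poly (Qmat K)).
  by rewrite -char_poly_Qspectrum signless_laplacianE map_char_poly.
split=> [eq_spec|eq_Q].
  have eq_char : char_poly (Qmat G) = char_poly (Qmat H).
    apply: (@map_inj_poly _ _ (intr : int -> algC)) => //; first exact: intr_inj.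
    by rewrite -!charE; apply: perm_big.
  have eq_card : #|G| = #|H|.
    by apply/eqP; rewrite -eqSS -!(size_char_poly (Qmat _)) eq_char.
  have := comp_char_poly G; rewrite eq_char comp_char_poly eq_card.
  by move/(can_inj (signrMK _)).
have eq_card : #|G| = #|H| by apply/eqP; rewrite -eqSS -!size_Qpoly eq_Q.
apply: prod_XsubC_eq; rewrite !charE; congr (map_poly _ _).
have oppK (p : {poly int}) : (p \Po - 'X) \Po - 'X = p.
  by rewrite -comp_polyA raddfN /= comp_polyX opprK comp_polyXr.
by rewrite -[LHS]oppK -[RHS]oppK !comp_char_poly eq_Q eq_card.
Qed.

(* The last two cases cannot occur in a graph whose number of edges is its
   number of vertices minus the multiplicity of the root 0. *)
Lemma connected_cases (G : sgraph) : Defs.connected G ->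
  [\/ [/\ degree_sum G + 2 = 2 * #|G|%:R, (Qpoly G).[0] = 0, (Qpoly G)^`().[0] = #|G|%:R
        & root (Qpoly G) (-2) -> (Qpoly G)^`().[-2] != 0],
      [/\ degree_sum G = 2 * #|G|%:R, (Qpoly G).[0] = 4,
          exists q c, (Qpoly G)^`().[0] = (1 + 2 * q) * #|G|%:R + 4 * c
        & root (Qpoly G) (-2) -> (Qpoly G)^`().[-2] != 0],
      [/\ degree_sum G = 2 * #|G|%:R, (Qpoly G).[0] = 0
        & exists s : G -> bool, forall x y, adj x y -> s x != s y]
    | 2 * #|G|%:R < degree_sum G].
Proof.
case=> /card_gt0P [x0 _] conn.
pose e : rel 'I_#|G| := fun i j => adj (enum_val i) (enum_val j).
have sym_e : symmetric e by move=> i j; apply: adj_sym.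
have irr_e : irreflexive e by move=> i; apply: adj_irrefl.
pose r := enum_rank x0.
have conn_e i : connect e r i.
  have /connectP [s] := conn x0 (enum_val i).
  elim: s x0 @r => [|y s IHs] x /=.
    by move=> _ xE; rewrite -[i]enum_valK xE; apply: connect0.
  move=> /andP[xy ys] iE; apply: connect_trans (IHs y ys iE).
  by apply: connect1; rewrite /e !enum_rankK.
have [p [h treeP]] := spanning_tree sym_e conn_e.
have sumE (F : G -> int) : \sum_x F x = \sum_(i < #|G|) F (enum_val i).
  have bij_val : bijective (fun i : 'I_#|G| => enum_val i) := enum_val_bij G.
  by apply: reindex; apply: onW_bij.
have dE : deg_sum e = degree_sum G.
  by rewrite /degree_sum sumE; apply: eq_bigr => i _; rewrite sumE.
have QE : \matrix_(i, j) qent e i j = Qmat G.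
  apply/matrixP => i j; rewrite !mxE /qent (inj_eq enum_val_inj); congr (_ * _ + _).
  by rewrite sumE.
have := component_cases sym_e irr_e treeP; rewrite dE QE -/(Qpoly G).
case=> [?|?|[? ? [s sP]]|?]; [exact: Or41|exact: Or42| |exact: Or44].
apply: Or43; split=> //; exists (s \o enum_rank) => x y xy /=.
by apply: sP; rewrite /e !enum_rankK.
Qed.

(** * Isomorphisms and components *)

Lemma iso_refl (G : sgraph) : isomorphic G G.
Proof. by exists id; split=> //; exists id. Qed.

Lemma iso_sym (G H : sgraph) : isomorphic G H -> isomorphic H G.
Proof.
case=> f [[g fK gK] adj_f]; exists g; split; first by exists f.
by move=> x y; rewrite -adj_f !gK.
Qed.

Lemma iso_trans (G H K : sgraph) :
  isomorphic G H -> isomorphic H K -> isomorphic G K.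
Proof.
case=> f [bij_f adj_f] [g [bij_g adj_g]]; exists (g \o f); split.
  exact: bij_comp.
by move=> x y; rewrite /= adj_g adj_f.
Qed.

Lemma iso_union (G G' H H' : sgraph) :
  isomorphic G G' -> isomorphic H H' ->
  isomorphic (disjoint_union G H) (disjoint_union G' H').
Proof.
case=> f [[f' fK f'K] adj_f] [g [[g' gK g'K] adj_g]].
exists (fun u => match u with inl x => inl (f x) | inr y => inr (g y) end); split.
  exists (fun u => match u with inl x => inl (f' x) | inr y => inr (g' y) end);
  by case=> x; rewrite ?fK ?gK ?f'K ?g'K.
by case=> x [] y //=.
Qed.

Lemma iso_unionC (G H : sgraph) :
  isomorphic (disjoint_union G H) (disjoint_union H G).
Proof.
exists (fun u => match u with inl x => inr x | inr y => inl y end); split.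
  by exists (fun u => match u with inl x => inr x | inr y => inl y end); case.
by case=> x [] y.
Qed.

Lemma iso_unionA (G H K : sgraph) :
  isomorphic (disjoint_union G (disjoint_union H K))
             (disjoint_union (disjoint_union G H) K).
Proof.
exists (fun u => match u with
  inl x => inl (inl x) | inr (inl y) => inl (inr y) | inr (inr z) => inr z end).
split.
  exists (fun u => match u with
    inl (inl x) => inl x | inl (inr y) => inr (inl y) | inr z => inr (inr z) end).
    by case=> [|[]].
  by case=> [[]|].
by case=> [x|[x|x]] [y|[y|y]].
Qed.

Lemma iso_card0 (G H : sgraph) : #|G| = 0%N -> #|H| = 0%N -> isomorphic G H.
Proof.
move=> G0 H0; have noG (x : G) : False by have := card0_eq G0 x.
have noH (x : H) : False by have := card0_eq H0 x.
exists (fun x => False_rect _ (noG x)); split=> [|x]; last by case: (noG x).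
by exists (fun y => False_rect _ (noH y)) => x; [case: (noG x)|case: (noH x)].
Qed.

Lemma iso_union0 (G H : sgraph) : #|H| = 0%N -> isomorphic (disjoint_union G H) G.
Proof.
move=> H0; have noH (x : H) : False by have := card0_eq H0 x.
exists (fun u => match u with inl x => x | inr y => False_rect _ (noH y) end).
split; last by case=> x [] y //=; case: (noH _).
exists inl => [|//]; case=> // y; by case: (noH y).
Qed.

Definition empty_graph : sgraph := complete 0.

Lemma card_empty_graph : #|empty_graph| = 0%N.
Proof. exact: card_ord. Qed.

Definition big_union (cs : seq sgraph) : sgraph :=
  foldr disjoint_union empty_graph cs.

(** * Splitting a graph into connected components *)

Section Induced.
Variables (G : sgraph) (A : {set G}).

Definition induced_adj : rel {x : G | x \in A} := fun u v => adj (val u) (val v).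

Lemma induced_adj_sym : symmetric induced_adj.
Proof. by move=> u v; apply: adj_sym. Qed.

Lemma induced_adj_irrefl : irreflexive induced_adj.
Proof. by move=> u; apply: adj_irrefl. Qed.

Definition induced : sgraph := SGraph induced_adj_sym induced_adj_irrefl.

Lemma card_induced : #|induced| = #|A|.
Proof. exact: card_sig. Qed.

End Induced.

Lemma iso_induced_union (G : sgraph) (A : {set G}) :
    (forall x y, adj x y -> (x \in A) = (y \in A)) ->
  isomorphic (disjoint_union (induced A) (induced (~: A))) G.
Proof.
move=> closedA.
exists (fun u : disjoint_union (induced A) (induced (~: A)) =>
  match u with inl x => val x | inr y => val y end); split.
  have disj (u : induced A) (v : induced (~: A)) : val u != val v.
    by apply: contraTneq (valP u) => ->; have := valP v; rewrite inE.
  apply: inj_card_bij; last by rewrite card_union !card_induced cardsC.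
  case=> u [] v uv; try by congr (_ _); apply: val_inj.
    by have := disj u v; rewrite uv eqxx.
  by have := disj v u; rewrite uv eqxx.
case=> u [] v //=; apply/negbTE/negP => /closedA.
  by have := valP v; rewrite (valP u) inE => /negPf ->.
by have := valP u; rewrite (valP v) inE => /negPf ->.
Qed.

(** Induction on the order: the vertices reachable from [x0] are closed under adjacency, so they
    split off as one component. *)
Lemma components (G : sgraph) : exists cs : seq sgraph,
  (forall i, (i < size cs)%N -> Defs.connected (nth empty_graph cs i)) /\
  isomorphic G (big_union cs).
Proof.
have [m] := ubnP #|G|; elim: m G => // m IHm G /ltnSE leGm.
have [G0|/card_gt0P [x0 _]] := posnP #|G|.
  by exists [::]; split=> //; apply: iso_card0 => //; apply: card_empty_graph.
have csym : connect_sym (@adj G) by apply: sym_connect_sym; apply: adj_sym.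
pose A := [set x | connect adj x0 x].
have closedA x y : adj x y -> (x \in A) = (y \in A).
  by move=> xy; rewrite !inE; apply: same_connect_r => //; apply: connect1.
have x0A : x0 \in A by rewrite inE connect0.
have isoG := iso_sym (iso_induced_union closedA).
have [|cs [conn_cs iso_cs]] := IHm (induced (~: A)).
  rewrite card_induced; apply: leq_trans leGm.
  by rewrite -(cardsC A) -[X in (X < _)%N]add0n ltn_add2r; apply/card_gt0P; exists x0.
exists (induced A :: cs); split; last first.
  by apply: iso_trans isoG _; apply: iso_union iso_cs; apply: iso_refl.
case=> [_|i]; last exact: conn_cs.
split; first by rewrite card_induced; apply/card_gt0P; exists x0.
(* Every prefix of a path of [G] from [x0] ends in [A], so the path lifts to the induced graph, one
   last vertex at a time. *)
have conn0 (u : induced A) : connect adj (exist _ x0 x0A : induced A) u.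
  case: u => x Ax; have := Ax; rewrite inE => /connectP [s].
  elim/last_ind: s x Ax => [|s y IHs] x Ax.
    move=> _ /= xE; apply: eq_connect0; apply: val_inj; exact: esym xE.
  rewrite rcons_path last_rcons => /andP[x0s sy] xE.
  have Al : last x0 s \in A by rewrite inE; apply/connectP; exists s.
  apply: connect_trans (IHs _ Al x0s erefl) _; apply: connect1.
  by rewrite /= /induced_adj /= xE.
move=> x y; apply: connect_trans (conn0 y).
have csymA : connect_sym (@adj (induced A)).
  by apply: sym_connect_sym; apply: adj_sym.
by rewrite csymA.
Qed.

Lemma monic_size1 (p : {poly int}) : p \is monic -> size p = 1%N -> p = 1.
Proof.
move=> mon_p /eqP/size_poly1P [c _ pE].
by move: mon_p; rewrite pE monicE lead_coefC => /eqP ->.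
Qed.

Lemma Qpoly_card0 (G : sgraph) : #|G| = 0%N -> Qpoly G = 1.
Proof.
by move=> G0; apply: monic_size1; [exact: monic_Qpoly|rewrite size_Qpoly G0].
Qed.

Lemma degree_sum_card0 (G : sgraph) : #|G| = 0%N -> degree_sum G = 0.
Proof. by move=> G0; rewrite /degree_sum big1 // => x; have := card0_eq G0 x. Qed.

Lemma Qpoly_big_union (cs : seq sgraph) :
  Qpoly (big_union cs) = \prod_(C <- cs) Qpoly C.
Proof.
elim: cs => [|C cs IHcs]; last by rewrite big_cons -IHcs; apply: Qpoly_union.
by rewrite big_nil Qpoly_card0 ?card_empty_graph.
Qed.

Lemma degree_sum_big_union (cs : seq sgraph) :
  degree_sum (big_union cs) = \sum_(C <- cs) degree_sum C.
Proof.
elim: cs => [|C cs IHcs]; last by rewrite big_cons -IHcs; apply: degree_sum_union.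
by rewrite big_nil degree_sum_card0 ?card_empty_graph.
Qed.

Lemma card_big_union (cs : seq sgraph) :
  #|big_union cs| = (\sum_(C <- cs) #|C|)%N.
Proof.
elim: cs => [|C cs IHcs]; last by rewrite big_cons -IHcs; apply: card_union.
by rewrite big_nil card_empty_graph.
Qed.

(** * Copies of K_1 and K_2 *)

Lemma iso_copies0 (G K : sgraph) : isomorphic (disjoint_union G (copies 0 K)) G.
Proof. by apply: iso_union0; rewrite card_prod card_ord. Qed.

Lemma iso_copiesS k (K : sgraph) :
  isomorphic (copies k.+1 K) (disjoint_union K (copies k K)).
Proof.
exists (fun u : copies k.+1 K =>
  if unlift ord0 u.1 is Some i then inr (i, u.2) else inl u.2); split.
  exists (fun v : disjoint_union K (copies k K) =>
    match v with inl x => (ord0, x) | inr u => (lift ord0 u.1, u.2) end).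
    by case=> i x /=; case: unliftP => [j|] ->.
  by case=> [x|[i x]] /=; rewrite ?unlift_none ?liftK.
case=> i x [j y] /=; rewrite /copies_adj /=.
by case: unliftP => [i'|] ->; case: unliftP => [j'|] ->;
   rewrite ?eqxx ?(inj_eq lift_inj).
Qed.

Lemma Qpoly_copies k (K : sgraph) : Qpoly (copies k K) = Qpoly K ^+ k.
Proof.
elim: k => [|k IHk]; first by rewrite Qpoly_card0 // card_prod card_ord.
by rewrite (Qpoly_iso (iso_copiesS _ _)) Qpoly_union IHk exprS.
Qed.

Lemma degree_sum_copies k (K : sgraph) : degree_sum (copies k K) = k%:R * degree_sum K.
Proof.
elim: k => [|k IHk]; first by rewrite degree_sum_card0 ?mul0r // card_prod card_ord.
rewrite (degree_sum_iso (iso_copiesS _ _)) degree_sum_union IHk.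
by rewrite -natr1 mulrDl mul1r addrC.
Qed.

Lemma Qpoly_complete1 : Qpoly (complete 1) = 'X.
Proof.
have bij_id : bijective (fun i : 'I_1 => i : complete 1) by exists id.
rewrite -(Qpoly_along bij_id) /pencil det_mx11 !mxE /qent big_ord1.
by rewrite [X in X%:P + _](_ : _ = 0) ?add0r ?eqxx ?mulr1 // adj_irrefl mulr0.
Qed.

Lemma Qpoly_complete2 : Qpoly (complete 2) = 'X * ('X + 2%:P).
Proof.
have bij_id : bijective (fun i : 'I_2 => i : complete 2) by exists id.
rewrite -(Qpoly_along bij_id) /pencil (expand_det_row _ ord0).
rewrite !big_ord_recl big_ord0 /cofactor !det_mx11 !mxE /qent.
rewrite !big_ord_recl !big_ord0 /= /complete_adj /=.
rewrite !(mul1r, mul0r, add0r, addr0, mulr0, mulr1, expr0, polyC1, polyC0).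
by rewrite polyCMn polyC1; ring.
Qed.

Lemma degree_sum_complete1 : degree_sum (complete 1) = 0.
Proof. by rewrite /degree_sum !big_ord1 adj_irrefl. Qed.

Lemma degree_sum_complete2 : degree_sum (complete 2) = 2.
Proof. by rewrite /degree_sum !big_ord_recl !big_ord0. Qed.

Lemma complete_iso (G : sgraph) :
  (forall x y : G, adj x y = (x != y)) -> isomorphic G (complete #|G|).
Proof.
move=> complG; exists enum_rank; split; first exact: enum_rank_bij.
by move=> x y; rewrite complG /= /complete_adj (inj_eq enum_rank_inj).
Qed.

Lemma iso_complete1 (G : sgraph) : #|G| = 1%N -> isomorphic G (complete 1).
Proof.
move=> G1; rewrite -G1; apply: complete_iso => x y.
have /card_le1_eqP eqG : (#|G| <= 1)%N by rewrite G1.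
by rewrite (eqG x y) // adj_irrefl eqxx.
Qed.

Lemma iso_complete2 (G : sgraph) :
  Defs.connected G -> #|G| = 2%N -> isomorphic G (complete 2).
Proof.
move=> [_ conn] G2; rewrite -G2; apply: complete_iso => x y.
have [->|xy] := eqVneq x y; first by rewrite adj_irrefl.
have /connectP [[|z s] /=] := conn x y; first by move=> _ yx; rewrite yx eqxx in xy.
move=> /andP[xz _] _; suff -> : y = z by [].
have zx : z != x by apply: contraTneq xz => ->; rewrite adj_irrefl.
apply/eqP/negPn/negP => yz; have := max_card (mem [:: x; y; z]).
by rewrite G2 (card_uniqP _) //= !inE (negPf xy) (negPf yz) eq_sym (negPf zx).
Qed.

Definition add_small (G : sgraph) (r s : nat) : sgraph :=
  disjoint_union (disjoint_union G (copies r (complete 1))) (copies s (complete 2)).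

Lemma Qpoly_add_small (G : sgraph) r s :
  Qpoly (add_small G r s) = 'X ^+ (r + s) * ('X + 2%:P) ^+ s * Qpoly G.
Proof.
rewrite !Qpoly_union !Qpoly_copies Qpoly_complete1 Qpoly_complete2 exprMn exprD.
by ring.
Qed.

Lemma iso_add_small (G H : sgraph) r s :
  isomorphic G H -> isomorphic (add_small G r s) (add_small H r s).
Proof.
move=> GH; apply: iso_union; last exact: iso_refl.
by apply: iso_union; last exact: iso_refl.
Qed.

(** [P] marks the components to keep. Each other one is moved by associativity and commutativity of
    the union into the copies of K_1 or K_2. *)
Lemma split_small (P : pred sgraph) (cs : seq sgraph) :
    (forall i, (i < size cs)%N -> ~~ P (nth empty_graph cs i) ->
       isomorphic (nth empty_graph cs i) (complete 1) \/
       isomorphic (nth empty_graph cs i) (complete 2)) ->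
  exists r s, isomorphic (big_union cs) (add_small (big_union (filter P cs)) r s).
Proof.
elim: cs => [_|C cs IHcs smallP].
  exists 0%N, 0%N; apply: iso_sym.
  exact: iso_trans (iso_copies0 _ _) (iso_copies0 _ _).
have [r [s iso_cs]] := IHcs (fun i => smallP i.+1).
rewrite /=; case: ifPn => [_|/(smallP 0%N isT) /= [isoC|isoC]].
- exists r, s; apply: iso_trans (iso_union (iso_refl C) iso_cs) _.
  apply: iso_trans (iso_unionA _ _ _) _; apply: iso_union; last exact: iso_refl.
  exact: iso_unionA.
- exists r.+1, s; apply: iso_trans (iso_union isoC iso_cs) _.
  apply: iso_trans (iso_unionA _ _ _) _; apply: iso_union; last exact: iso_refl.
  apply: iso_trans (iso_unionA _ _ _) _.
  apply: iso_trans (iso_union (iso_unionC _ _) (iso_refl _)) _.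
  apply: iso_trans (iso_sym (iso_unionA _ _ _)) _.
  by apply: iso_union; [exact: iso_refl|apply/iso_sym/iso_copiesS].
exists r, s.+1; apply: iso_trans (iso_union isoC iso_cs) _.
apply: iso_trans (iso_unionA _ _ _) _.
apply: iso_trans (iso_union (iso_unionC _ _) (iso_refl _)) _.
apply: iso_trans (iso_sym (iso_unionA _ _ _)) _.
by apply: iso_union; [exact: iso_refl|apply/iso_sym/iso_copiesS].
Qed.

(** * Arithmetic of the components *)

Lemma monic_size2 (p : {poly int}) :
  p \is monic -> size p = 2%N -> p = 'X + (p.[0])%:P.
Proof.
move=> mon_p p2; have lead1 : p`_1 = 1 by have := monicP mon_p; rewrite lead_coefE p2.
apply/polyP => i; rewrite coefD coefX coefC horner_coef0.
case: i => [|[|i]] /=; rewrite ?add0r ?addr0 //.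
by rewrite nth_default ?p2.
Qed.

(** All other terms being even, [n] is even too, so [2 * a * n] is a multiple of 4 and the odd
    factor disappears modulo 4. *)
Lemma double_odd_mul (x n a c : int) :
  2 * x = (1 + 2 * a) * n + 4 * c -> exists d, 2 * x = n + 4 * d.
Proof.
move=> xE; have [m nE] : exists m, n = 2 * m by exists (x - a * n - 2 * c); lia.
by exists (a * m + c); rewrite xE nE; ring.
Qed.

Section ComponentArithmetic.
(** Component [j] has order [n j] and polynomial ['X ^+ t j * ('X + 2) ^+ i j * q j]. The original
    graph has order [N] and polynomial [('X + 2) ^+ g * qG], whose value 4 at 0 yields [sum_e]. In
    [kinds], trees come first and odd unicyclic components second. *)
Variables (k : nat) (t i n e : 'I_k -> nat) (q : 'I_k -> {poly int}).
Variables (N g s : nat) (qG : {poly int}).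
Hypothesis sum_i : (\sum_j i j = s + g)%N.
Hypothesis sum_n : (\sum_j n j = N + s + \sum_j t j)%N.
Hypothesis sum_e : (\sum_j e j + g = 2)%N.
Hypothesis prod_q : \prod_j q j = qG.
Hypothesis i_le1 : forall j, (i j <= 1)%N.
Hypothesis monic_q : forall j, q j \is monic.
Hypothesis size_q : forall j, (t j + i j + size (q j) = (n j).+1)%N.
Hypothesis q0 : forall j, (q j).[0] = 2 ^+ e j.
Hypothesis qm2 : forall j, (q j).[-2] != 0.
Hypothesis kinds : forall j,
  (t j = 1 /\ n j = 2 ^ (i j + e j))%N \/
  [/\ t j = 0%N, (e j + i j = 2)%N & exists a c,
    (('X + 2%:P) ^+ i j * q j)^`().[0] = (1 + 2 * a) * (n j)%:R + 4 * c].
Hypothesis dqG : exists a c,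
  (('X + 2%:P) ^+ g * qG)^`().[0] = (1 + 2 * a) * N%:R + 4 * c.

(** Such a tree has order [2 ^ i j = i j + 1], so the powers of ['X] and ['X + 2] exhaust the degree
    of its polynomial. *)
Lemma no_excess j : t j = 1%N -> e j = 0%N -> n j = (i j + t j)%N /\ q j = 1.
Proof.
move=> tj ej; case: (kinds j) => [[_ nj]|[]]; last by rewrite tj.
have := size_q j; have := i_le1 j; rewrite nj ej tj addn0.
case: (i j) => [|[|//]] _ sz; split=> //; apply: monic_size1 => //.
  by move: sz => [].
by move: sz => [].
Qed.

Lemma exists_unicyclic : (7 <= N)%N -> exists j, t j = 0%N.
Proof.
move=> N_ge7.
case: (pickP (fun j => t j == 0%N)) => [j /eqP tj|all_t]; first by exists j.
have tree j : t j = 1%N /\ n j = (2 ^ (i j + e j))%N.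
  by case: (kinds j) => [//|[tj _ _]]; have := all_t j; rewrite tj.
(* For [i <= 1] and [e <= 2], [2 ^ (i + e)] is at most [i + 3 * e + 1]. Summed over the components,
   this gives [N + 2 * g <= 6]. *)
have bound j : (n j <= i j + 3 * e j + t j)%N.
  have [-> ->] := tree j; have := i_le1 j.
  have : (e j <= 2)%N by rewrite -sum_e (bigD1 j) //= -addnA leq_addr.
  by case: (e j) => [|[|[|//]]] _; case: (i j) => [|[|//]].
have : (\sum_j n j <= \sum_j i j + 3 * \sum_j e j + \sum_j t j)%N.
  by rewrite big_distrr -!big_split; apply: leq_sum => j _.
by move: sum_i sum_n sum_e; lia.
Qed.

Lemma deriv_horner0 (p p' : {poly int}) :
  (p * p')^`().[0] = p^`().[0] * p'.[0] + p.[0] * p'^`().[0].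
Proof. by rewrite derivM hornerD !hornerM. Qed.

Lemma deriv_linear0 (p : {poly int}) :
  (('X + 2%:P) * p)^`().[0] = p.[0] + 2 * p^`().[0].
Proof. by rewrite deriv_horner0 derivD derivX derivC !hornerE. Qed.

(** Two unicyclic components force [e = i = 1] for both and [g = 0], with only K_1 and K_2 besides;
    then [N + 2 = n j + n j']. Modulo 4, the linear coefficients make both [N] and [n j + n j']
    congruent to twice the sum of the derivatives of [q j] and [q j'] at 0, a contradiction. *)
Lemma single_unicyclic j j' : t j = 0%N -> t j' = 0%N -> j = j'.
Proof.
move=> tj tj'; apply/eqP; apply/negPn/negP => neq.
have uni l : t l = 0%N -> (e l + i l = 2)%N /\ exists a c,
    (('X + 2%:P) ^+ i l * q l)^`().[0] = (1 + 2 * a) * (n l)%:R + 4 * c.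
  by move=> tl; case: (kinds l) => [[]|[]]; rewrite tl.
have [eij [a [c dq]]] := uni j tj; have [eij' [a' [c' dq']]] := uni j' tj'.
pose P l := (l != j) && (l != j').
have D2 (f : 'I_k -> nat) : (\sum_l f l = f j + (f j' + \sum_(l | P l) f l))%N.
  by rewrite (bigD1 j) //= (bigD1 j') //= eq_sym.
have D2q : \prod_l q l = q j * (q j' * \prod_(l | P l) q l).
  by rewrite (bigD1 j) //= (bigD1 j') //= eq_sym.
have ij := i_le1 j; have ij' := i_le1 j'.
have [e0 [ij1 [ij1' g0]]] : (\sum_(l | P l) e l = 0 /\ i j = 1 /\ i j' = 1 /\ g = 0)%N.
  by move: sum_e; rewrite D2; lia.
have rest l : P l -> n l = (i l + t l)%N /\ q l = 1.
  move=> Pl; have el : e l = 0%N.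
    by move/eqP: e0; rewrite sum_nat_eq0 => /forall_inP/(_ l Pl)/eqP.
  by apply: no_excess => //; case: (kinds l) => [[]//|[_]]; have := i_le1 l; lia.
have nE : (N + 2 = n j + n j')%N.
  move: sum_n sum_i; rewrite !D2 tj tj'.
  rewrite (eq_bigr (fun l => i l + t l)%N) => [|l /rest[]//].
  by rewrite big_split /=; lia.
have qGE : qG = q j * q j'.
  by rewrite -prod_q D2q [X in _ * (_ * X)]big1 ?mulr1 // => l /rest[].
have [aG [cG]] := dqG.
rewrite g0 qGE expr0 mul1r deriv_horner0.
move: dq dq'; rewrite ij1 ij1' expr1 !deriv_linear0 !q0.
have [-> ->] : e j = 1%N /\ e j' = 1%N by lia.
have two1 (x : int) : 2 + 2 * x = 2 * (1 + x) by ring.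
rewrite !expr1 !two1 => /double_odd_mul[d dE].
move=> /double_odd_mul[d' dE'] dG.
have /double_odd_mul [dG' dGE] : 2 * ((q j)^`().[0] + (q j')^`().[0]) =
  (1 + 2 * aG) * N%:R + 4 * cG by rewrite -dG; ring.
by lia.
Qed.

(** A tree with [e j' > 0] beside the unicyclic component must have order 4, and then [N = n j + 1].
    The linear coefficients make both [n j] and [N] even, which is absurd. *)
Lemma others_small j : t j = 0%N ->
  forall j', j' != j -> t j' = 1%N /\ (n j' = 1 \/ n j' = 2)%N.
Proof.
move=> tj j' neq.
have [tj' nj'] : t j' = 1%N /\ n j' = (2 ^ (i j' + e j'))%N.
  case: (kinds j') => [//|[tj' _ _]].
  by rewrite (single_unicyclic tj tj') eqxx in neq.
have [ej'|ej'] := posnP (e j').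
  split=> //; have [-> _] := no_excess tj' ej'.
  by have := i_le1 j'; rewrite tj'; lia.
exfalso.
have [eij [a [c dq]]] : (e j + i j = 2)%N /\ exists a c,
    (('X + 2%:P) ^+ i j * q j)^`().[0] = (1 + 2 * a) * (n j)%:R + 4 * c.
  by case: (kinds j) => [[]|[]]; rewrite tj.
pose P l := (l != j) && (l != j').
have D2 (f : 'I_k -> nat) : (\sum_l f l = f j + (f j' + \sum_(l | P l) f l))%N.
  by rewrite (bigD1 j) //= (bigD1 j').
have D2q : \prod_l q l = q j * (q j' * \prod_(l | P l) q l).
  by rewrite (bigD1 j) //= (bigD1 j').
have ij := i_le1 j; have ij' := i_le1 j'.
have [e0 [ij1 [ej1 [ej1' g0]]]] :
    (\sum_(l | P l) e l = 0 /\ i j = 1 /\ e j = 1 /\ e j' = 1 /\ g = 0)%N.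
  by move: sum_e; rewrite D2; lia.
have rest l : P l -> n l = (i l + t l)%N /\ q l = 1.
  case/andP=> lj lj'.
  have el : e l = 0%N.
    move/eqP: e0; rewrite sum_nat_eq0 => /forall_inP e0.
    by apply/eqP/e0; rewrite /P lj.
  apply: no_excess => //; case: (kinds l) => [[]//|[tl _ _]].
  by rewrite (single_unicyclic tj tl) eqxx in lj.
(* With [i j' = 0] the tree would have order 2 and [q j' = 'X + 2], which vanishes at -2. *)
have ij1' : i j' = 1%N.
  case: (posnP (i j')) => [ij0|]; last by lia.
  have := qm2 j'; rewrite (monic_size2 (monic_q j')) ?q0 ?ej1'.
    by rewrite !hornerE.
  by have := size_q j'; rewrite nj' tj' ij0 ej1'; lia.
have nE : (N = n j + 1)%N.
  move: sum_n sum_i; rewrite !D2 tj tj' nj' ij1' ej1'.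
  rewrite (eq_bigr (fun l => i l + t l)%N) => [|l /rest[]//].
  by rewrite big_split /=; lia.
have qGE : qG = q j * q j'.
  by rewrite -prod_q D2q [X in _ * (_ * X)]big1 ?mulr1 // => l /rest[].
have [aG [cG]] := dqG.
rewrite g0 qGE expr0 mul1r deriv_horner0 !q0 ej1 ej1' expr1 => dG.
have two1 (x : int) : 2 + 2 * x = 2 * (1 + x) by ring.
move: dq; rewrite ij1 expr1 deriv_linear0 q0 ej1 expr1 two1.
move=> /double_odd_mul[d dE].
have /double_odd_mul [dG' dGE] : 2 * ((q j)^`().[0] + (q j')^`().[0]) =
  (1 + 2 * aG) * N%:R + 4 * cG by rewrite -dG; ring.
by lia.
Qed.

End ComponentArithmetic.

(** * Cospectral graphs *)

Lemma factor_0m2 (p : {poly int}) : p \is monic -> exists t i q,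
  [/\ p = 'X ^+ t * (('X + 2%:P) ^+ i * q), q \is monic, q.[0] != 0 & q.[-2] != 0].
Proof.
move=> mon_p; have p0 := monic_neq0 mon_p.
have [t [q1]] := multiplicity_XsubC p 0; rewrite p0 /= subr0 => q10 pE.
have [i [q]] := multiplicity_XsubC q1 (-2).
have q1_neq0 : q1 != 0 by apply: contraNneq q10 => ->; rewrite root0.
rewrite q1_neq0 /= polyCN opprK => qm2 q1E.
have pE' : p = 'X ^+ t * (('X + 2%:P) ^+ i * q) by rewrite pE q1E; ring.
exists t, i, q; split=> //.
  move: mon_p; rewrite pE' monicMl ?monicXn // monicMl // monic_exp //.
  exact: monicXaddC.
by apply: contraNneq q10 => qz; rewrite q1E rootM rootE qz eqxx.
Qed.

Lemma XsubC_exp_uniq (R : idomainType) (a : R) m l (p p' : {poly R}) :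
    p.[a] != 0 -> p'.[a] != 0 ->
    ('X - a%:P) ^+ m * p = ('X - a%:P) ^+ l * p' -> m = l /\ p = p'.
Proof.
wlog le_ml : m l p p' / (m <= l)%N => [hwlog pa p'a eq_p|pa p'a].
  case/orP: (leq_total m l) => le; first exact: hwlog.
  by have [-> ->] := hwlog _ _ _ _ le p'a pa (esym eq_p).
rewrite -(subnKC le_ml) exprD -mulrA => /mulfI pE.
have {}pE : p = ('X - a%:P) ^+ (l - m) * p'.
  by apply: pE; rewrite expf_neq0 // polyXsubC_eq0.
move: pa; rewrite pE; case: (l - m)%N => [|d]; first by rewrite addn0 expr0 mul1r.
by rewrite exprS !hornerE subrr !mul0r eqxx.
Qed.

Lemma factor_0m2_uniq t i (q : {poly int}) t' i' (q' : {poly int}) :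
    q.[0] != 0 -> q.[-2] != 0 -> q'.[0] != 0 -> q'.[-2] != 0 ->
    'X ^+ t * (('X + 2%:P) ^+ i * q) = 'X ^+ t' * (('X + 2%:P) ^+ i' * q') ->
  [/\ t = t', i = i' & q = q'].
Proof.
have nz (j : nat) (p : {poly int}) : p.[0] != 0 -> (('X + 2%:P) ^+ j * p).[0] != 0.
  by move=> p0; rewrite !hornerE mulf_neq0 // expf_neq0.
have X2E : 'X + 2%:P = 'X - (-2)%:P :> {poly int} by rewrite polyCN opprK.
move=> q0 q2 q'0 q'2; rewrite -[X in X ^+ t]subr0 -[X in X ^+ t']subr0 -polyC0 => eqP0.
have {eqP0}[-> eqP2] := XsubC_exp_uniq (nz i q q0) (nz i' q' q'0) eqP0.
by rewrite X2E in eqP2; have [-> ->] := XsubC_exp_uniq q2 q'2 eqP2.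
Qed.

(** The ordered adjacent pairs are grouped by their underlying edge, and each group consists of the
    two orientations. *)
Lemma degree_sum_edges (G : sgraph) : degree_sum G = 2 * #|edges G|%:R.
Proof.
pose A := [set p : G * G | adj p.1 p.2].
have -> : degree_sum G = (#|A|)%:R.
  rewrite /degree_sum -sum1_card natr_sum pair_big big_mkcond [RHS]big_mkcond /=.
  by apply: eq_bigr => p _; rewrite inE; case: adj.
rewrite -natrM; congr (_%:R); rewrite -sum1_card.
have edgesE : edges G = [set [set p.1; p.2] | p in A].
  apply/setP => E; apply/idP/idP => /imsetP[p pA ->]; apply/imsetP; exists p => //;
  by move: pA; rewrite !inE.
rewrite (partition_big_imset (fun p : G * G => [set p.1; p.2])) -edgesE.
rewrite mulnC -sum_nat_const; apply: eq_bigr => E; rewrite edgesE => /imsetP [[x y]].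
rewrite inE /= => xy ->.
have ne_xy : x != y by apply: contraTneq xy => ->; rewrite adj_irrefl.
rewrite sum1dep_card (_ : [set _ | _] = [set (x, y); (y, x)]).
  by rewrite cards2 xpair_eqE (negPf ne_xy).
apply/setP => -[a b]; rewrite !inE /= !xpair_eqE.
apply/andP/orP => [[ab /eqP abE]|].
  have ne_ab : a != b by apply: contraTneq ab => ->; rewrite adj_irrefl.
  have := set21 a b; have := set22 a b; rewrite abE !inE.
  case/orP=> /eqP bE /orP[] /eqP aE; move: ne_ab; rewrite aE bE ?eqxx // => _.
    by right.
  by left.
case=> /andP[/eqP-> /eqP->]; split; rewrite ?eqxx // 1?adj_sym //.
by rewrite setUC.
Qed.

Lemma path_colour (G : sgraph) (c : G -> bool) x p :
    (forall x y : G, adj x y -> c x != c y) -> path adj x p ->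
  c (last x p) = c x (+) odd (size p).
Proof.
move=> colour; elim: p x => [|y p IHp] x /=; first by rewrite addbF.
case/andP=> /colour xy /IHp ->; move: xy.
by case: (c x); case: (c y); case: (odd _).
Qed.

Lemma odd_cycle_not_bipartite (G : sgraph) (s : seq G) (c : G -> bool) :
  is_cycle s -> odd (size s) -> ~ (forall x y : G, adj x y -> c x != c y).
Proof.
case=> /andP[cyc_s _] _ odd_s colour; case: s cyc_s odd_s => //= x p cyc_p odd_p.
have := path_colour colour cyc_p; rewrite last_rcons size_rcons /= odd_p.
by case: (c x).
Qed.

(** The exponent [t] is the multiplicity of the root 0. A bipartite unicyclic component has [t > 0],
    so it falls with the denser components in the strict third case, which the global count excludes
    later. *)
Lemma component_data (C : sgraph) : Defs.connected C -> exists t i q,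
  [/\ Qpoly C = 'X ^+ t * (('X + 2%:P) ^+ i * q),
      q \is monic, q.[0] != 0, q.[-2] != 0 &
  [\/ [/\ degree_sum C + 2 * t%:R = 2 * #|C|%:R, t = 1%N, (i <= 1)%N
        & (#|C|)%:R = 2 ^+ i * q.[0]],
      [/\ degree_sum C + 2 * t%:R = 2 * #|C|%:R, t = 0%N, (i <= 1)%N, 2 ^+ i * q.[0] = 4
        & exists a c, (('X + 2%:P) ^+ i * q)^`().[0] = (1 + 2 * a) * #|C|%:R + 4 * c]
    | 2 * #|C|%:R < degree_sum C + 2 * t%:R]].
Proof.
move=> connC; have [t [i [q [QE mon_q q0 qm2]]]] := factor_0m2 (monic_Qpoly C).
exists t, i, q; split=> //.
have i_le1 : (root (Qpoly C) (-2) -> (Qpoly C)^`().[-2] != 0) -> (i <= 1)%N.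
  case: i QE => [|[|i]] // QE; set w := 'X ^+ t * (('X + 2%:P) ^+ i * q).
  have -> : Qpoly C = ('X + 2%:P) * (('X + 2%:P) * w) by rewrite QE !exprS /w; ring.
  rewrite rootE derivM !hornerM hornerD hornerX hornerC addNr mul0r eqxx.
  rewrite hornerD !hornerM hornerD hornerX hornerC addNr !mul0r mulr0 addr0 eqxx.
  by move/(_ isT).
have Q0 : (Qpoly C).[0] = 0 ^+ t * (2 ^+ i * q.[0]).
  by rewrite QE !hornerE.
case: (connected_cases connC).
- case=> dE Qz dQ simple; apply: Or31.
  (* [t = 0] contradicts the root at 0, and [t >= 2] would make the derivative there vanish,
     although it is the order of [C]. *)
  have t1 : t = 1%N.
    case: t QE Q0 => [|[|t]] // QE Q0.
      move/eqP: Q0; rewrite Qz mul1r eq_sym mulf_eq0 (negPf q0) orbF.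
      by rewrite expf_eq0 andbF.
    move: dQ; set w := 'X ^+ t * (('X + 2%:P) ^+ i * q).
    have -> : Qpoly C = 'X * ('X * w) by rewrite QE !exprS /w; ring.
    rewrite derivM hornerD !hornerM !hornerX !mul0r mulr0 addr0 => /esym/eqP.
    by rewrite pnatr_eq0 => /eqP C0; have [] := connC; rewrite C0.
  split=> //; first by rewrite t1 mulr1.
    exact: i_le1.
  rewrite -dQ QE t1 expr1 derivM derivX.
  by rewrite !hornerE.
- case=> dE Q4 dQ simple; apply: Or32.
  have t0 : t = 0%N by case: t Q0 {QE} => // t; rewrite expr0n mul0r Q4.
  rewrite t0 expr0 mul1r in QE.
  split=> //.
  + by rewrite t0 mulr0 addr0.
  + exact: i_le1.
  + by rewrite -Q4 Q0 t0 mul1r.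
  by have [a [c aE]] := dQ; exists a, c; rewrite -QE.
- case=> dE Qz _; apply: Or33.
  have : (0 < t)%N.
    rewrite lt0n; apply: contra_eqN Qz => /eqP t0.
    by rewrite Q0 t0 mul1r mulf_neq0 ?expf_neq0.
  by rewrite dE; lia.
by move=> dE; apply: Or33; lia.
Qed.

(** The edge count rules out trees and denser graphs, and the odd cycle rules out a proper
    2-colouring, so only the case with value 4 at 0 remains. *)
Lemma odd_unicyclic_data (G : sgraph) : odd_unicyclic G -> exists g q,
  [/\ degree_sum G = 2 * #|G|%:R, Qpoly G = ('X + 2%:P) ^+ g * q,
      q.[0] != 0 /\ q.[-2] != 0, 2 ^+ g * q.[0] = 4 &
      exists a c, (('X + 2%:P) ^+ g * q)^`().[0] = (1 + 2 * a) * #|G|%:R + 4 * c].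
Proof.
case=> -[connG edgesG] [s [cyc_s odd_s]].
have dE : degree_sum G = 2 * #|G|%:R by rewrite degree_sum_edges edgesG.
have Q0 : (Qpoly G).[0] != 0.
  case: (connected_cases connG) => [[]|[_ -> _ _]|[_ _ [c]]|] //.
  - by rewrite dE; lia.
  - by move=> /(odd_cycle_not_bipartite cyc_s odd_s).
  - by rewrite dE ltxx.
have [t [g [q [QE _ q0 qm2 kind]]]] := component_data connG.
have t0 : t = 0%N.
  by case: t QE {kind} Q0 => // t ->; rewrite exprS -mulrA hornerM hornerX mul0r eqxx.
rewrite t0 expr0 mul1r in QE kind; exists g, q; split=> //.
all: by case: kind => [[]|[]|]; rewrite ?dE ?mulr0 ?addr0 ?ltxx.
Qed.

Lemma filter_single (T : Type) (x0 : T) (P : pred T) (s : seq T) j :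
    (j < size s)%N -> (forall i, (i < size s)%N -> P (nth x0 s i) = (i == j)) ->
  filter P s = [:: nth x0 s j].
Proof.
move=> lt_j Ps; rewrite -{1}(cat_take_drop j s) (drop_nth x0 lt_j) filter_cat /=.
rewrite Ps // eqxx; set s1 := filter _ _; set s2 := filter _ _.
have -> : s1 = [::].
  apply/nilP; rewrite /nilp size_filter -leqn0 leqNgt -has_count.
  apply/negP => /(has_nthP x0)[i].
  rewrite size_take lt_j => lt_i; rewrite nth_take // Ps ?(ltn_trans lt_i) //.
  by rewrite (ltn_eqF lt_i).
have -> // : s2 = [::].
apply/nilP; rewrite /nilp size_filter -leqn0 leqNgt -has_count.
apply/negP => /(has_nthP x0)[i].
rewrite size_drop ltn_subRL => lt_i; rewrite nth_drop Ps //.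
by rewrite gtn_eqF // leq_addr.
Qed.

Lemma prod_pow2 k (m : 'I_k -> nat) g :
    (2 ^ g * \prod_j m j = 4)%N ->
  exists2 e : 'I_k -> nat, forall j, m j = (2 ^ e j)%N & (\sum_j e j + g = 2)%N.
Proof.
move=> prod_m.
have pow j : exists a, m j = (2 ^ a)%N.
  have : (m j %| 2 ^ 2)%N.
    by rewrite -[(2 ^ 2)%N]prod_m (bigD1 j) //= dvdn_mull // dvdn_mulr.
  by case/(dvdn_pfactor _ _ (isT : prime 2)) => a _ ->; exists a.
have [e eE] := fin_all_exists pow; exists e => //.
apply: (@expnI 2) => //; rewrite -[RHS]prod_m addnC expnD expn_sum.
by congr (_ * _)%N; apply: eq_bigr => j _.
Qed.

Lemma DQS_add_small (G : sgraph) (r s : nat) :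
  DQS G -> odd_unicyclic G -> (7 <= #|G|)%N -> DQS (add_small G r s).
Proof.
move=> dqsG oddG G_ge7 H /perm_QspectrumP; rewrite Qpoly_add_small => QH.
have [g [qG [dG QG [qG0 qGm2] qG4 dqG]]] := odd_unicyclic_data oddG.
have [cs [conn_cs isoH]] := components H.
pose C (j : 'I_(size cs)) := nth empty_graph cs j.
have /fin_all_exists [t] :=
  fun j : 'I_(size cs) => component_data (conn_cs j (ltn_ord j)).
case/fin_all_exists=> i /fin_all_exists [q dataC].
pose T : sgraph := add_small G r s.
have QHT : Qpoly H = Qpoly T by rewrite QH Qpoly_add_small.
have cardT : #|T| = (#|G| + r + 2 * s)%N.
  by rewrite !card_union !card_prod !card_ord muln1 mulnC.
have cardH : #|H| = #|T| by apply/eqP; rewrite -eqSS -!size_Qpoly QHT.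
have dT : degree_sum T = 2 * #|G|%:R + 2 * s%:R.
  rewrite !degree_sum_union !degree_sum_copies.
  by rewrite degree_sum_complete1 degree_sum_complete2 dG; ring.
have dH : degree_sum H = degree_sum T.
  by rewrite -!coef_Qpoly_degree_sum ?QHT ?cardH //; rewrite cardT; lia.
have sum_card : (\sum_j #|C j| = #|G| + r + 2 * s)%N.
  by rewrite -cardT -cardH (card_iso isoH) card_big_union (big_nth empty_graph) big_mkord.
have sum_dsum : \sum_j degree_sum (C j) = 2 * #|G|%:R + 2 * s%:R.
  rewrite -dT -dH (degree_sum_iso isoH).
  by rewrite degree_sum_big_union (big_nth empty_graph) big_mkord.
(* The multiplicities of 0 and -2 and the cofactor are unique, so they can be compared on both
   sides. *)
have [sum_t sum_i prod_q] :
    [/\ (\sum_j t j = r + s)%N, (\sum_j i j = s + g)%N & \prod_j q j = qG].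
  have q0 : (\prod_j q j).[0] != 0.
    by rewrite horner_prod; apply/prodf_neq0 => j _; have [] := dataC j.
  have qm2 : (\prod_j q j).[-2] != 0.
    by rewrite horner_prod; apply/prodf_neq0 => j _; have [] := dataC j.
  apply: factor_0m2_uniq => //.
  rewrite [_ ^+ (s + g)]exprD -[_ * qG]mulrA -QG [RHS]mulrA -QH.
  rewrite (Qpoly_iso isoH) Qpoly_big_union (big_nth empty_graph) big_mkord.
  rewrite -!prodrXr -!big_split /=.
  by apply: eq_bigr => j _; have [] := dataC j.
(* Each term is nonnegative by [component_data], and the terms add up to 0. *)
have tight j : degree_sum (C j) + 2 * (t j)%:R - 2 * #|C j|%:R = 0.
  move: j (erefl true); apply: psumr_eq0P => [j _|].
    by rewrite subr_ge0; have [_ _ _ _ []] := dataC j; [case=> ->|case=> ->|move/ltW].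
  rewrite sumrB big_split /= sum_dsum -!mulr_sumr -!natr_sum sum_t sum_card.
  by lia.
have kind j : [/\ (i j <= 1)%N, 0 < (q j).[0] &
    (t j = 1%N /\ (#|C j|)%:R = 2 ^+ i j * (q j).[0]) \/
    [/\ t j = 0%N, 2 ^+ i j * (q j).[0] = 4 & exists a c,
      (('X + 2%:P) ^+ i j * q j)^`().[0] = (1 + 2 * a) * #|C j|%:R + 4 * c]].
  have [_ _ _ _ []] := dataC j.
  - case=> _ tj ij nE; split=> //; last by left.
    have [C_gt0 _] := conn_cs j (ltn_ord j).
    by rewrite -(pmulr_rgt0 _ (exprn_gt0 (i j) (isT : (0 : int) < 2))) -nE ltr0n.
  - case=> _ tj ij nE dq; split=> //; last by right.
    by rewrite -(pmulr_rgt0 _ (exprn_gt0 (i j) (isT : (0 : int) < 2))) nE.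
  by rewrite -subr_gt0 tight ltxx.
have absq j : ((absz (q j).[0])%:Z = (q j).[0]) by have [_ /ltW/gez0_abs] := kind j.
have [e eE sum_e] : exists2 e : 'I_(size cs) -> nat,
    forall j, absz (q j).[0] = (2 ^ e j)%N & (\sum_j e j + g = 2)%N.
  apply: prod_pow2; rewrite -[RHS]/(absz 4) -qG4 -prod_q abszM abszX; congr (_ * _)%N.
  by rewrite horner_prod (big_morph absz abszM absz1).
have q0E j : (q j).[0] = 2 ^+ e j by rewrite -absq eE -natz natrX.
have sum_n : (\sum_j #|C j| = #|G| + s + \sum_j t j)%N by rewrite sum_card sum_t; lia.
have i_le1 j : (i j <= 1)%N by have [] := kind j.
have monic_q j : q j \is monic by have [] := dataC j.
have qm2 j : (q j).[-2] != 0 by have [] := dataC j.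
have size_q j : (t j + i j + size (q j) = #|C j|.+1)%N.
  have [QE mon_q _ _ _] := dataC j; rewrite -size_Qpoly QE.
  have X2E : 'X + 2%:P = 'X - (-2)%:P :> {poly int} by rewrite polyCN opprK.
  have mon_i : ('X - (-2)%:P : {poly int}) ^+ i j \is monic.
    by rewrite monic_exp ?monicXsubC.
  rewrite X2E size_Mmonic ?monicMl ?monic_neq0 ?monicXn // size_Mmonic ?monic_neq0 //.
  by rewrite size_polyXn size_exp_XsubC addSn addSn /= addnA.
have kinds j : (t j = 1 /\ #|C j| = 2 ^ (i j + e j))%N \/
    [/\ t j = 0%N, (e j + i j = 2)%N & exists a c,
      (('X + 2%:P) ^+ i j * q j)^`().[0] = (1 + 2 * a) * #|C j|%:R + 4 * c].
  have [_ _ [[tj nE]|[tj iE dq]]] := kind j; [left|right]; split=> //.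
    by apply/eqP; rewrite -eqz_nat -natz nE q0E -exprD -natrX natz.
  apply: (@expnI 2) => //; apply/eqP.
  by rewrite -eqz_nat -!natz natrX exprD -q0E mulrC iE.
have [j0 tj0] := exists_unicyclic sum_i sum_n sum_e i_le1 kinds G_ge7.
have others := others_small sum_i sum_n sum_e prod_q i_le1 monic_q size_q q0E qm2
  kinds dqG tj0.
(* A nonzero value at 0 distinguishes the unicyclic component from the trees. *)
pose P : pred sgraph := fun K => (Qpoly K).[0] != 0.
have PC (j : 'I_(size cs)) : P (C j) = (j == j0).
  rewrite /P; have [-> _ q0 _ _] := dataC j.
  have [jE|jj0] := eqVneq j j0.
    by rewrite jE tj0 -jE expr0 mul1r !hornerE mulf_eq0 (negPf q0) orbF expf_eq0 andbF.
  by have [-> _] := others j jj0; rewrite expr1 hornerM hornerX mul0r eqxx.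
have [|r' [s' iso_cs]] := @split_small P cs.
  move=> j lt_j notP; pose jo := Ordinal lt_j.
  have jj0 : jo != j0 by rewrite -PC.
  have [_ [C1|C2]] := others jo jj0; [left; exact: iso_complete1|right].
  exact: iso_complete2 (conn_cs j lt_j) C2.
have filterE : filter P cs = [:: C j0].
  apply: filter_single => // j lt_j; exact: (PC (Ordinal lt_j)).
pose U := C j0.
have isoHU : isomorphic H (add_small U r' s').
  apply: iso_trans isoH _; apply: iso_trans iso_cs _; rewrite filterE.
  by apply: iso_add_small; apply: iso_union0; apply: card_empty_graph.
have [QU _ qU0 qUm2 _] := dataC j0; rewrite -/U tj0 expr0 mul1r in QU.
have [_ _ [[tj _]|[_ qU4 _]]] := kind j0; first by rewrite tj0 in tj.
have [rs' sg qUG] : [/\ (r' + s' = r + s)%N, (s' + i j0 = s + g)%N & q j0 = qG].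
  apply: factor_0m2_uniq => //.
  have := QH; rewrite (Qpoly_iso isoHU) Qpoly_add_small QU QG.
  by rewrite ![_ ^+ (_ + _) * _ * _]mulrA !exprD -!mulrA.
(* The factorization alone leaves [s' + i j0 = s + g]. Both unicyclic graphs have value 4 at 0 and
   share the cofactor [qG], so their powers of 2 agree. *)
have iU : i j0 = g.
  have : (2 : int) ^+ i j0 == 2 ^+ g.
    by rewrite -(inj_eq (mulIf qG0)) -{1}qUG qU4 qG4.
  by rewrite -!natrX eqr_nat eqn_exp2l // => /eqP.
have ss' : s' = s by lia.
have rr' : r' = r by lia.
have QUG : Qpoly U = Qpoly G by rewrite QU QG iU qUG.
rewrite ss' rr' in isoHU; apply: iso_trans isoHU _; apply: iso_add_small.
by apply: dqsG; apply/perm_QspectrumP.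
Qed.

Local Close Scope ring_scope.
Unset Implicit Arguments.

Theorem theorem3p2 (G : sgraph) (r s : nat) :
  DQS G -> odd_unicyclic G -> 7 <= #|G| ->
  DQS (disjoint_union (disjoint_union G (copies r (complete 1)))
                      (copies s (complete 2))).
Proof. exact: DQS_add_small. Qed.
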